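(* Let $0<x<1$ and $t>0$. Let $\alpha^2$ be a positive random variable and let $\{\phi(y):0\le y\le1\}$ be a process in $L^2([0,1]\times\Omega)$ with Karhunen-Loève expansion $$\phi(y)(\omega)=\mu_\phi(y)+\sum_{m=1}^\infty\sqrt{\nu_m}\,\phi_m(y)\,\xi_m(\omega),\qquad \nu_1>0,$$ such that, for every $N\ge3$, $\alpha^2$, $\xi_1$ and $(\xi_2,\ldots,\xi_{N-1})$ are absolutely continuous and independent random vectors. Suppose that the density $f_{\xi_1}$ is Lipschitz on $\mathbb R$ and that $\alpha^2(\omega)\in\mathcal D:=\bigcap_{N=1}^\infty\mathcal D_N$ for a.e. $\omega\in\Omega$, where $\mathcal D_N=\{\alpha^2>0:\ T_N(\phi_1)(x,t,\alpha^2)\ne0\}$. Assume that $\sum_{n=1}^\infty\|e^{-n^2\pi^2\alpha^2t}\|_{L^2(\Omega)}<\infty$ and that there is a constant $C(x,t)>0$ such that $|T_N(\phi_1)(x,t,\alpha^2(\omega))|\ge C(x,t)$ for a.e. $\omega\in\Omega$ and all $N$. Then the density $f_{u_{N,N}(x,t)}$ of the random variable $$u_{N,N}(x,t)(\omega)=2\,T_N(\mu_\phi)(x,t,\alpha^2(\omega))+2\sum_{m=1}^{N-1}T_N(\phi_m)(x,t,\alpha^2(\omega))\sqrt{\nu_m}\,\xi_m(\omega)$$ converges, as $N\to\infty$, in $L^\infty(K)$ for every bounded set $K\subseteq\mathbb R$, to a density of the random variable $$u(x,t)(\omega)=\sum_{n=1}^\infty A_n(\omega)e^{-n^2\pi^2\alpha^2(\omega)t}\sin(n\pi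 x),\qquad A_n(\omega)=2\int_0^1\phi(y)(\omega)\sin(n\pi y)\,dy .$$
   Context: All random objects live on a complete probability space $(\Omega,\mathcal F,\mathbb P)$. $L^2([0,1]\times\Omega)$ is the space of measurable $f$ on $[0,1]\times\Omega$ with $\mathbb E[\int_0^1|f(y)|^2dy]<\infty$. Integrals defining $A_n$ are Lebesgue integrals for fixed $\omega$. Karhunen-Loève expansion of $\phi$: $\mu_\phi(y)=\mathbb E[\phi(y)]$; $\{(\nu_m,\phi_m)\}_{m\ge1}$ are the pairs of (nonnegative) eigenvalues and eigenfunctions of the operator $\mathcal C:L^2(0,1)\to L^2(0,1)$, $\mathcal Cf(s)=\int_0^1\mathrm{Cov}[\phi(s),\phi(r)]f(r)\,dr$, with $\{\phi_m\}_{m\ge1}$ an orthonormal basis of $L^2(0,1)$; $\{\xi_m\}_{m\ge1}$ are random variables with zero expectation, unit variance, pairwise uncorrelated; the series converges in $L^2([0,1]\times\Omega)$. No particular ordering of the pairs $(\nu_m,\phi_m)$ is assumed (so which pair has index $1$ is a free choice). For $f\in L^2(0,1)$, $N\ge1$ and $\alpha^2>0$ a real number, $$T_N(f)(x,t,\alpha^2)=\sum_{n=1}^N\hat f(n)\,e^{-n^2\pi^2\alpha^2t}\sin(n\pi x),\qquad \hat f(n)=\int_0^1f(y)\sin(n\pi y)\,dy .$$ $f_X$ denotes the probability density function of an absolutely continuous random vector $X$. The density of $u_{N,N}(x,t)$ is given by $$f_{u_{N,N}(x,t)}(u)=\int_{\mathbb R^{N-2}\times\mathcal D_N}f_{(\xi_1,\ldots,\xi_{N-1},\alpha^2)}\left(\frac{\frac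 u2-T_N(\mu_\phi)(x,t,\alpha^2)-\sum_{m=2}^{N-1}T_N(\phi_m)(x,t,\alpha^2)\sqrt{\nu_m}\,\xi_m}{\sqrt{\nu_1}\,T_N(\phi_1)(x,t,\alpha^2)},\xi_2,\ldots,\xi_{N-1},\alpha^2\right)\frac{1}{2\sqrt{\nu_1}\,|T_N(\phi_1)(x,t,\alpha^2)|}\,d\xi_2\cdots d\xi_{N-1}\,d\alpha^2 ,$$ where, inside the integral, $\alpha^2,\xi_2,\ldots,\xi_{N-1}$ are real integration variables. *)

(* Defs.v *)
From HB Require Import structures.
From mathcomp Require Import all_boot all_order all_algebra.
From mathcomp Require Import all_classical all_reals all_analysis.

Set Implicit Arguments.
Unset Strict Implicit.
Unset Printing Implicit Defensive.

Import Order.TTheory GRing.Theory Num.Theory.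
Import numFieldNormedType.Exports.

Local Open Scope classical_set_scope.
Local Open Scope ring_scope.

(* R^n with the product (= Borel) sigma-algebra. *)
Notation vec R n := (n.-tuple (measurableTypeR R)).

Definition vcons (R : realType) (n : nat)
    (p : (measurableTypeR R * vec R n)%type) : vec R n.+1 :=
  [tuple of p.1 :: p.2].

Definition vuncons (R : realType) (n : nat)
    (v : vec R n.+1) : (measurableTypeR R * vec R n)%type :=
  (thead v, [tuple of behead v]).

Lemma vconsK (R : realType) n : cancel (@vcons R n) (@vuncons R n).
Proof. by case=> a v; congr pair; apply: val_inj. Qed.

Lemma vunconsK (R : realType) n : cancel (@vuncons R n) (@vcons R n).
Proof. by move=> v; rewrite [RHS]tuple_eta; apply: val_inj. Qed.

Lemma measurable_vcons (R : realType) n : measurable_fun [set: _] (@vcons R n).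
Proof.
apply: (@measurable_cons _ _ (measurableTypeR R * vec R n)%type
  (measurableTypeR R) fst n snd).
- exact: measurable_fst.
- exact: measurable_snd.
Qed.

Lemma measurable_vuncons (R : realType) n :
  measurable_fun [set: _] (@vuncons R n).
Proof.
apply/measurable_fun_pairP; split.
- exact: (@measurable_tnth _ (measurableTypeR R) n.+1 ord0).
- exact: (@measurable_behead _ (measurableTypeR R) n).
Qed.

Section lebesgue_vcons.
Context {R : realType} {n : nat}.
Variable mu : {sigma_finite_measure set (vec R n) -> \bar R}.
Local Notation m := (@lebesgue_measure R \x mu)%E.

Definition lebesgue_vcons : set (vec R n.+1) -> \bar R :=
  pushforward m (@vcons R n).

Let mpre (A : set (vec R n.+1)) :
  measurable A -> measurable (@vcons R n @^-1` A).
Proof. by move=> mA; rewrite -[X in measurable X]setTI; exact: measurable_vcons. Qed.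

Let lebesgue_vcons0 : lebesgue_vcons set0 = 0%E.
Proof. by rewrite /lebesgue_vcons /pushforward preimage_set0 measure0. Qed.

Let lebesgue_vcons_ge0 A : (0 <= lebesgue_vcons A)%E.
Proof. by rewrite /lebesgue_vcons /pushforward; exact: measure_ge0. Qed.

Let lebesgue_vcons_sigma_additive : semi_sigma_additive lebesgue_vcons.
Proof.
move=> F mF tF mUF; rewrite /lebesgue_vcons /pushforward preimage_bigcup.
apply: measure_semi_sigma_additive.
- by move=> i; exact: mpre.
- apply/trivIsetP => /= i j _ _ ij; rewrite -preimage_setI.
  by move/trivIsetP : tF => /(_ _ _ _ _ ij) ->//; rewrite preimage_set0.
- by rewrite -preimage_bigcup; exact: mpre.
Qed.

HB.instance Definition _ := isMeasure.Build _ _ _ lebesgue_vcons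
  lebesgue_vcons0 lebesgue_vcons_ge0 lebesgue_vcons_sigma_additive.

Let lebesgue_vcons_sigma_finite : sigma_finite setT lebesgue_vcons.
Proof.
have /sigma_finiteP[F [TF ndF Foo]] := sigma_finiteT (@lebesgue_measure R).
have /sigma_finiteP[G [TG ndG Goo]] := sigma_finiteT mu.
exists (fun i => @vuncons R n @^-1` (F i `*` G i)).
  rewrite -preimage_bigcup (_ : \bigcup_i _ = setT) ?preimage_setT//.
  rewrite -setXTT TF TG predeqE => -[x y]; split => [[i _ []/= ? ?]|].
    by split; exists i.
  move=> [/= [i _ Fx] [k _ Gy]]; exists (maxn i k) => //; split.
  - by move: x Fx; exact/subsetPset/ndF/leq_maxl.
  - by move: y Gy; exact/subsetPset/ndG/leq_maxr.
move=> i; have [mF Fi] := Foo i; have [mG Gi] := Goo i; split.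
  rewrite -[X in measurable X]setTI; apply: measurable_vuncons => //.
  exact: measurableX.
rewrite /lebesgue_vcons /pushforward -comp_preimage.
rewrite (_ : _ \o _ = id); last by apply/funext => x; exact: vconsK.
by rewrite preimage_id product_measure1E// lte_mul_pinfty// ge0_fin_numE.
Qed.

HB.instance Definition _ :=
  Measure_isSigmaFinite.Build _ _ _ lebesgue_vcons lebesgue_vcons_sigma_finite.

End lebesgue_vcons.

(* n-dimensional Lebesgue measure, by iterating the product measure. *)
Fixpoint lebesgue_vec (R : realType) (n : nat) :
    {sigma_finite_measure set (vec R n) -> \bar R} :=
  match n with
  | 0 => \d_ ([tuple] : vec R 0)
  | n'.+1 => lebesgue_vcons (lebesgue_vec R n')
  end.

Lemma lebesgue_vec_box (R : realType) n (A : 'I_n -> set (measurableTypeR R)) :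
  (forall i, measurable (A i)) ->
  lebesgue_vec R n [set v | forall i, A i (tnth v i)] =
    (\prod_(i < n) lebesgue_measure (A i))%E.
Proof.
elim: n A => [|n IH] A mA.
  rewrite big_ord0 /= diracE mem_set// => -[]//.
rewrite big_ord_recl -IH//= /lebesgue_vcons /pushforward.
rewrite -product_measure1E//=; last first.
  rewrite (_ : [set _ | _] =
      \bigcap_(i in [set: 'I_n]) (@tnth n _ ^~ i @^-1` A (lift ord0 i))); last first.
    by apply/seteqP; split=> [v h i _|v h i]; exact: h.
  apply: fin_bigcap_measurable => // i _.
  by rewrite -[X in measurable X]setTI; exact: measurable_tnth.
congr (_ _); apply/seteqP; split=> [[a v] /= h|[a v] /= [ha hv] i].
  split; first exact: (h ord0).
  by move=> i; have := h (lift ord0 i); rewrite tnthS.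
by case: (unliftP ord0 i) => [j|] ->; rewrite ?tnthS.
Qed.

(* Lebesgue measure on R^N, with R^N seen as R x R^(N-2) x R (for N >= 2). *)
Definition lebesgue_joint (R : realType) (N : nat) :
    {measure set (measurableTypeR R * vec R (N - 2) * measurableTypeR R)%type
       -> \bar R} :=
  (@lebesgue_measure R \x lebesgue_vec R (N - 2) \x @lebesgue_measure R)%E.

Section random_vectors.
Context {d d1 d2 d3 : measure_display} {T : measurableType d} {R : realType}.
Context {T1 : measurableType d1} {T2 : measurableType d2}.
Context {T3 : measurableType d3}.
Variable P : probability T R.

(* f is a version of the density of X with respect to mu. *)
Definition is_density (mu : {measure set T1 -> \bar R}) (X : T -> T1)
    (f : T1 -> R) :=
  [/\ measurable_fun [set: T] X,
      measurable_fun [set: T1] f,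
      (forall y, 0 <= f y) &
      (forall A, measurable A -> P (X @^-1` A) = \int[mu]_(y in A) (f y)%:E)%E].

Definition absolutely_continuous (mu : {measure set T1 -> \bar R})
    (X : T -> T1) :=
  exists f : T1 -> R, is_density mu X f.

(* Taking some of the sets to be the full space gives the product rule for the
   pairs as well, so this is mutual independence. *)
Definition independent3 (X : T -> T1) (Y : T -> T2) (Z : T -> T3) :=
  forall (A : set T1) (B : set T2) (C : set T3),
    measurable A -> measurable B -> measurable C ->
    P (X @^-1` A `&` Y @^-1` B `&` Z @^-1` C) =
    (P (X @^-1` A) * P (Y @^-1` B) * P (Z @^-1` C))%E.

End random_vectors.

Section L2_01.
Context {R : realType}.
Local Notation leb := (@lebesgue_measure R).

Definition L2_01 (f : R -> R) :=
  measurable_fun (`[0, 1] : set R) f /\ (\int[leb]_(y in `[0%R, 1%R]) ((f y) ^+ 2)%:E < +oo)%E.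

Definition dot_01 (f g : R -> R) : R := \int[leb]_(y in `[0, 1]) (f y * g y).

(* Orthonormal, and every f in L^2(0,1) is the L^2-sum of its expansion. *)
Definition orthonormal_basis_01 (e : nat -> R -> R) :=
  [/\ forall m, L2_01 (e m),
      forall m k, dot_01 (e m) (e k) = (m == k)%:R &
      forall f, L2_01 f ->
        (\int[leb]_(y in `[0%R, 1%R])
           ((f y - \sum_(m < M) dot_01 f (e m) * e m y) ^+ 2)%:E)%E
        @[M --> \oo] --> 0%E].

Definition sin_coef (f : R -> R) (n : nat) : R :=
  \int[leb]_(y in `[0, 1]) (f y * sin (n%:R * pi * y)).

Definition heat_sum (N : nat) (f : R -> R) (x t a : R) : R :=
  \sum_(1 <= n < N.+1)
    sin_coef f n * expR (- (n%:R ^+ 2 * pi ^+ 2 * a * t)) * sin (n%:R * pi * x).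

Definition heat_dom (N : nat) (f : R -> R) (x t : R) : set R :=
  [set a | 0 < a /\ heat_sum N f x t a != 0].

Definition heat_dom_all (f : R -> R) (x t : R) : set R :=
  \bigcap_(N in [set N | (1 <= N)%N]) heat_dom N f x t.

End L2_01.

Section process.
Context {d : measure_display} {T : measurableType d} {R : realType}.
Variable P : probability T R.
Local Notation leb := (@lebesgue_measure R).

Definition L2_process (phi : R -> T -> R) :=
  measurable_fun ((`[0, 1] : set R) `*` [set: T]) (fun p : R * T => phi p.1 p.2) /\
  (\int[P]_w \int[leb]_(y in `[0%R, 1%R]) ((phi y w) ^+ 2)%:E < +oo)%E.

Definition mean (phi : R -> T -> R) (y : R) : R := fine 'E_P[phi y]%E.

Definition cov_op (phi : R -> T -> R) (f : R -> R) (s : R) : R :=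
  \int[leb]_(r in `[0, 1]) (fine (covariance P (phi s) (phi r)) * f r).

(* The term of index m here is the term of index m+1 of the usual expansion;
   the operator equation is an equality in L^2(0,1), i.e. almost everywhere. *)
Record karhunen_loeve (phi : R -> T -> R) (nu : nat -> R)
    (phi_ : nat -> R -> R) (xi : nat -> {RV P >-> R}) : Prop := {
  kl_eigenvalue_ge0 : forall m, 0 <= nu m ;
  kl_basis : orthonormal_basis_01 phi_ ;
  kl_eigen : forall m, {ae leb, forall s, s \in `[0, 1] ->
    cov_op phi (phi_ m) s = nu m * phi_ m s} ;
  kl_mean0 : forall m, ('E_P[xi m] = 0)%E ;
  kl_var1 : forall m, ('V_P[xi m] = 1)%E ;
  kl_uncorrelated : forall m k, m != k -> covariance P (xi m) (xi k) = 0%E ;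
  kl_cvg :
    (\int[P]_w \int[leb]_(y in `[0%R, 1%R])
      ((phi y w - mean phi y
        - \sum_(m < M) Num.sqrt (nu m) * phi_ m y * xi m w) ^+ 2)%:E)%E
    @[M --> \oo] --> 0%E }.

Definition heat_solution (phi : R -> T -> R) (alpha2 : T -> R) (x t : R)
    (w : T) : R :=
  limn (fun N => \sum_(1 <= n < N.+1)
    2 * sin_coef (phi ^~ w) n * expR (- (n%:R ^+ 2 * pi ^+ 2 * alpha2 w * t))
      * sin (n%:R * pi * x)).

(* u_{N,N}; with indices shifted by one the sum runs over m = 0, ..., N-2. *)
Definition heat_approx (phi : R -> T -> R) (nu : nat -> R)
    (phi_ : nat -> R -> R) (xi : nat -> T -> R) (alpha2 : T -> R) (x t : R)
    (N : nat) (w : T) : R :=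
  2 * heat_sum N (mean phi) x t (alpha2 w)
  + 2 * \sum_(m < N.-1)
      heat_sum N (phi_ m) x t (alpha2 w) * Num.sqrt (nu m) * xi m w.

(* (xi_2, ..., xi_{N-1}) in the usual numbering. *)
Definition xi_tail (xi : nat -> T -> R) (N : nat) (w : T) : vec R (N - 2) :=
  [tuple xi (val i).+1 w | i < N - 2].

(* (xi_1, ..., xi_{N-1}, alpha^2), with R^N seen as R x R^(N-2) x R. *)
Definition joint_vector (xi : nat -> T -> R) (alpha2 : T -> R) (N : nat)
    (w : T) : (measurableTypeR R * vec R (N - 2) * measurableTypeR R)%type :=
  (xi 0%N w, xi_tail xi N w, alpha2 w).

(* The density of u_{N,N}, from a density fj of (xi_1, ..., xi_{N-1}, alpha^2);
   the integration variables are p.1 = (xi_2, ..., xi_{N-1}), p.2 = alpha^2. *)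
Definition heat_approx_density (phi : R -> T -> R) (nu : nat -> R)
    (phi_ : nat -> R -> R) (x t : R) (N : nat)
    (fj : (measurableTypeR R * vec R (N - 2) * measurableTypeR R)%type -> R)
    (v : R) : R :=
  \int[(lebesgue_vec R (N - 2) \x leb)%E]_(p in
      [set: vec R (N - 2)] `*` heat_dom N (phi_ 0%N) x t)
    (fj ((v / 2 - heat_sum N (mean phi) x t p.2
           - \sum_(i < N - 2) heat_sum N (phi_ i.+1) x t p.2
               * Num.sqrt (nu i.+1) * tnth p.1 i)
         / (Num.sqrt (nu 0%N) * heat_sum N (phi_ 0%N) x t p.2), p.1, p.2)
     / (2 * Num.sqrt (nu 0%N) * `|heat_sum N (phi_ 0%N) x t p.2|)).

End process.

(* Main.v *)
(* Write u_N = b_N + a_N xi_1 with a_N = 2 sqrt(nu_1) T_N(phi_1)(x, t, alpha^2),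
   where (a_N, b_N) is a function of (xi_2, ..., xi_{N-1}, alpha^2).

   For fixed values of the latter, the substitution v = b_N + a_N y in Tonelli's
   theorem turns the joint density into the stated density of u_N. Since xi_1
   is independent of (a_N, b_N), another version of this density is
     f_N(v) = E[f_{xi_1}((v - u_N) / a_N + xi_1) / |a_N|].
   As f_{xi_1} is Lipschitz, hence bounded, and |a_N| is bounded below, f_N
   converges uniformly on bounded sets to the same expression f in the limits
   of a_N and u_N, as soon as a_N converges almost surely and u_N converges in
   probability. A portmanteau argument on the intervals ]a, b] shows that f is
   a density of the limit.

   Almost surely alpha^2 > 0, so q = exp(- pi^2 alpha^2 t) < 1, and |T_N(f)| is at
   most |f|_{L^1(0,1)} / (1 - q); this gives the convergence of a_N and of the
   series u. By linearity u_N - 2 T_N(phi) is controlled by the L^1(0,1)-distance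
   of phi to its Karhunen-Loeve partial sum, whose expectation tends to 0. *)
From HB Require Import structures.
Require Import Defs.
From mathcomp Require Import all_boot all_order all_algebra.
From mathcomp Require Import all_classical all_reals all_analysis.
From mathcomp Require Import measurable_realfun ess_sup_inf ring lra.

Set Implicit Arguments.
Unset Strict Implicit.
Unset Printing Implicit Defensive.

Import Order.TTheory GRing.Theory Num.Theory.
Import numFieldNormedType.Exports.

Local Open Scope classical_set_scope.
Local Open Scope ring_scope.

(** * Affine substitution *)

(** The joint density of (xi_1, ..., xi_{N-1}, alpha^2) is an arbitrary version, free on null sets,
    so the stated formula cannot be estimated at a given point v. The norm of L^infty(K) only sees
    its almost everywhere class, and the estimates are made on the version f_N, whose integrand
    involves f_{xi_1} alone.

    Convergence of u_N in probability is what the data give directly: the Karhunen-Loeve series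
    converges in mean square, and the factor 1 / (1 - q) is finite almost surely but need not be
    bounded, as alpha^2 may come close to 0. The quantity E[min(1, |W|)] suits this: it is
    subadditive, it tolerates a finite random factor, and it appears by itself in the bound on f_N -
    f, whose integrand is both bounded and locally Lipschitz in (a, u).

    In the portmanteau argument, the usual condition that the endpoints carry no mass of the limit
    law is replaced by a bound common to all the densities f_N, which controls the mass of u_N near
    an endpoint uniformly in N. *)

Lemma measurable_invr (R : realType) : measurable_fun [set: R] (@GRing.inv R).
Proof.
rewrite -(setvU [set (0 : R)]); apply/measurable_funU => //.
  exact: measurableC.
split; last exact: measurable_fun_set1.
apply: open_continuous_measurable_fun.
  by apply: closed_openC; exact: closed_eq.
by move=> x; rewrite inE => /= /eqP x0; exact: inv_continuous.
Qed.

Lemma measurable_fun_inv d (T : measurableType d) (R : realType) (D : set T)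
    (f : T -> R) :
  measurable_fun D f -> measurable_fun D (fun x => (f x)^-1).
Proof. by move=> mf; exact: (measurableT_comp (@measurable_invr R)). Qed.

(** A named map, so that it carries a structure of measurable function and Lebesgue measure can be
    pushed forward along it. *)
Definition affine (R : realType) (a b : R) :
  measurableTypeR R -> measurableTypeR R := fun y => b + a * y.

Lemma measurable_affine (R : realType) (a b : R) :
  measurable_fun [set: measurableTypeR R] (affine a b).
Proof. by apply: measurable_funD => //; exact: measurable_funM. Qed.

HB.instance Definition _ (R : realType) (a b : R) :=
  isMeasurableFun.Build _ _ _ _ _ (measurable_affine a b).

(** Multiplied by |a|, the image measure gives every half-open interval its length, and this
    characterizes Lebesgue measure. *)
Lemma lebesgue_measure_affine (R : realType) (a b : R) (A : set R) :
  a != 0 -> measurable A ->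
  pushforward lebesgue_measure (affine a b) A =
  (`|a|^-1%:E * lebesgue_measure A)%E.
Proof.
move=> a0 mA.
have na0 : 0 < `|a| by rewrite normr_gt0.
pose k : {nonneg R} := NngNum (ltW na0).
suff /(_ (measurable_affine a b) _ mA) -> : forall B, measurable B ->
    lebesgue_measure B = mscale k (pushforward lebesgue_measure (affine a b)) B.
  by rewrite /mscale/= muleA -EFinM mulVf ?mul1e// gt_eqF.
move=> mf; apply: lebesgue_measure_unique => _ [[c d]] _ <-.
rewrite lebesgue_measure_itv/=.
transitivity (`|a|%:E * lebesgue_measure (affine a b @^-1` `]c, d]))%E; last by [].
(* The first case is a < 0, where the preimage of []c, d]] is closed on the left and open on the
   right, with the endpoints exchanged; the second is 0 < a. *)
have [a_gt0|a_lt0|/eqP] := ltrgtP a 0; last by rewrite (negbTE a0).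
- rewrite (_ : _ @^-1` _ = `[(d - b) / a, (c - b) / a[%classic); last first.
    apply/seteqP; split=> y /=; rewrite /affine !in_itv/= ler_ndivrMr// ltr_ndivlMr//.
      by move=> /andP[? ?]; apply/andP; split; lra.
    by move=> /andP[? ?]; apply/andP; split; lra.
  rewrite lebesgue_measure_itv/= !lte_fin ltr_nM2r ?invr_lt0// ltrD2r.
  case: ifPn => _; last by rewrite mule0.
  rewrite -!EFinB -EFinM ltr0_norm//; congr EFin.
  by field.
- rewrite (_ : _ @^-1` _ = `](c - b) / a, (d - b) / a]%classic); last first.
    apply/seteqP; split=> y /=; rewrite /affine !in_itv/= ler_pdivlMr// ltr_pdivrMr//.
      by move=> /andP[? ?]; apply/andP; split; lra.
    by move=> /andP[? ?]; apply/andP; split; lra.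
  rewrite lebesgue_measure_itv/= !lte_fin ltr_pM2r ?invr_gt0// ltrD2r.
  case: ifPn => _; last by rewrite mule0.
  rewrite -!EFinB -EFinM gtr0_norm//; congr EFin.
  by field.
Qed.

Lemma ge0_integral_affine (R : realType) (a b : R) (h : R -> \bar R) :
  a != 0 -> measurable_fun [set: measurableTypeR R] h ->
  (forall y, (0 <= h y)%E) ->
  (\int[lebesgue_measure]_y h (b + a * y)%R =
   `|a|^-1%:E * \int[lebesgue_measure]_y h y)%E.
Proof.
move=> a0 mh h0.
have na0 : 0 <= `|a|^-1 by rewrite invr_ge0.
pose k : {nonneg R} := NngNum na0.
transitivity (\int[pushforward lebesgue_measure (affine a b)]_y h y)%E.
  by rewrite ge0_integral_pushforward//= ?preimage_setT//.
rewrite (eq_measure_integral (mscale k lebesgue_measure)).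
  by rewrite ge0_integral_mscale.
by move=> A mA _ /=; rewrite /mscale lebesgue_measure_affine.
Qed.

Section affine_substitution.
Context (R : realType) d (S : measurableType d).
Variable mu : {sigma_finite_measure set S -> \bar R}.
Variables (D : set S) (a b : S -> R) (g : measurableTypeR R * S -> R).
Hypotheses (mD : measurable D) (ma : measurable_fun [set: S] a).
Hypotheses (mb : measurable_fun [set: S] b) (aD : forall p, D p -> a p != 0).
Hypothesis mg : measurable_fun [set: measurableTypeR R * S] g.
Hypothesis g0 : forall z, 0 <= g z.

Let h (z : measurableTypeR R * S) :=
  g ((z.1 - b z.2) / a z.2, z.2) / `|a z.2|.

Let h0 z : 0 <= h z. Proof. by rewrite divr_ge0. Qed.

Let mh : measurable_fun setT h.
Proof.
apply: measurable_funM.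
  apply: (measurableT_comp mg).
  apply/measurable_fun_pair => //; apply: measurable_funM.
    apply: measurable_funB => //.
    by apply: measurableT_comp => //; exact: measurable_snd.
  apply: measurable_fun_inv.
  by apply: measurableT_comp => //; exact: measurable_snd.
apply: measurable_fun_inv; apply: measurableT_comp => //.
by apply: measurableT_comp => //; exact: measurable_snd.
Qed.

(** Both domains of integration become indicator factors, so that Tonelli applies on the full
    product. Off [D], where the slope may vanish, the second factor cancels the quotient. *)
Let H (A : set R) (z : measurableTypeR R * S) :=
  (\1_A z.1 * \1_D z.2 * h z)%:E.

Let mH A : measurable A -> measurable_fun setT (H A).
Proof.
move=> mA; apply/measurable_EFinP/measurable_funM => //; apply: measurable_funM.
  by apply: measurableT_comp => //; exact: measurable_fst.
apply: measurableT_comp; first exact: measurable_indic.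
exact: measurable_snd.
Qed.

Let H0 A z : (0 <= H A z)%E. Proof. by rewrite lee_fin !mulr_ge0. Qed.

Let integral_H A v : v \in A -> (\int[mu]_p H A (v, p) =
  \int[mu]_(p in D) (g ((v - b p) / a p, p) / `|a p|)%R%:E)%E.
Proof.
move=> vA; rewrite [RHS]integral_mkcond; apply: eq_integral => p _.
rewrite /H/= patchE indicE vA mul1r indicE; case: ifPn => _.
  by rewrite mul1r.
by rewrite mul0r.
Qed.

Lemma measurable_fubini_affine : measurable_fun [set: measurableTypeR R]
  (fun v => \int[mu]_(p in D) (g ((v - b p) / a p, p) / `|a p|)%R%:E)%E.
Proof.
rewrite (_ : (fun v => _) = (fun v => \int[mu]_p H setT (v, p))%E).
  by apply: measurable_fun_fubini_tonelli_F => //; exact: mH.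
by apply/funext => v; rewrite integral_H// inE.
Qed.

(* The affine substitution v = b p + a p * y, for each fixed p. *)
Lemma fubini_affine (A : set R) : measurable A ->
  (\int[mu]_(p in D) \int[lebesgue_measure]_y
      (\1_A (b p + a p * y) * g (y, p))%R%:E =
   \int[lebesgue_measure]_(v in A) \int[mu]_(p in D)
      (g ((v - b p) / a p, p) / `|a p|)%R%:E)%E.
Proof.
move=> mA.
transitivity (\int[mu]_p \int[lebesgue_measure]_v H A (v, p))%E; last first.
  rewrite -(@fubini_tonelli _ _ _ _ _ _ _ (H A))//; last exact: mH.
  rewrite [RHS]integral_mkcond.
  apply: eq_integral => v _; rewrite patchE; case: ifPn => vA.
    exact: integral_H.
  rewrite integral0_eq// => p _; rewrite /H/= indicE (negbTE vA).
  by rewrite !mul0r.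
rewrite integral_mkcond; apply: eq_integral => p _; rewrite patchE.
case: ifPn => pD; last first.
  by rewrite integral0_eq// => v _; rewrite /H/= [\1_D _]indicE (negbTE pD)
    mulr0 mul0r.
have ap0 : a p != 0 by apply: aD; rewrite inE in pD.
pose q v := (\1_A v * g ((v - b p) / a p, p))%:E.
transitivity (\int[lebesgue_measure]_y q (b p + a p * y)%R)%E.
  apply: eq_integral => y _; rewrite /q; congr (_ * g (_, _))%:E.
  by field.
have mgp : measurable_fun setT (fun v : R => g ((v - b p) / a p, p)).
  apply: (measurableT_comp mg); apply/measurable_fun_pair => //.
  by apply: measurable_funM => //; exact: measurable_funB.
rewrite ge0_integral_affine//; last 2 first.
- by apply/measurable_EFinP/measurable_funM.
- by move=> v; rewrite lee_fin mulr_ge0.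
rewrite -ge0_integralZl//.
- apply: eq_integral => v _; rewrite /q /H/= [\1_D _]indicE pD mulr1 -EFinM.
  by congr EFin; rewrite /h/=; ring.
- by apply/measurable_EFinP/measurable_funM.
- by move=> v _; rewrite lee_fin mulr_ge0.
Qed.

End affine_substitution.

Lemma ae_iff_measure_eq d (T : measurableType d) (R : realType)
    (mu : {measure set T -> \bar R}) (A B : set T) :
  measurable A -> measurable B -> {ae mu, forall x, A x <-> B x} ->
  mu A = mu B.
Proof.
move=> mA mB AB; rewrite -[A]setIT -[B]setIT -!integral_indic//.
apply: ge0_ae_eq_integral => //; try exact/measurable_EFinP.
apply: filterS AB => x AB _; congr EFin; rewrite !indicE.
by suff -> : (x \in A) = (x \in B) by []; apply/idP/idP; rewrite !inE => /AB.
Qed.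

(** * Densities *)

Section sigma_finite_product.
Context d1 d2 (T1 : measurableType d1) (T2 : measurableType d2) (R : realType).
Variables (m1 : {sigma_finite_measure set T1 -> \bar R})
  (m2 : {sigma_finite_measure set T2 -> \bar R}).

(* An alias of [m1 \x m2], for which inference only finds a sigma-finite
   structure when both measures are finite. *)
Definition sigma_finite_product : set (T1 * T2) -> \bar R := (m1 \x m2)%E.

HB.instance Definition _ := Measure.copy sigma_finite_product (m1 \x m2)%E.

Let sigma_finite_product_sigma_finite : sigma_finite setT sigma_finite_product.
Proof.
have /sigma_finiteP[F [TF ndF Foo]] := sigma_finiteT m1.
have /sigma_finiteP[G [TG ndG Goo]] := sigma_finiteT m2.
exists (fun i => F i `*` G i).
  rewrite -setXTT TF TG predeqE => -[x y]; split => [[/= [n _ Fx] [k _ Gy]]|].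
    exists (maxn n k) => //; split.
    - by move: x Fx; exact/subsetPset/ndF/leq_maxl.
    - by move: y Gy; exact/subsetPset/ndG/leq_maxr.
  by move=> [n _ []]; split; exists n.
move=> i; have [mF Fi] := Foo i; have [mG Gi] := Goo i.
split; first exact: measurableX.
by rewrite /sigma_finite_product product_measure1E// lte_mul_pinfty// ge0_fin_numE.
Qed.

HB.instance Definition _ := Measure_isSigmaFinite.Build _ _ _
  sigma_finite_product sigma_finite_product_sigma_finite.

End sigma_finite_product.

(** Partial integrals are extended-valued, densities are real. As the integral of [F] is a
    probability, [F] is finite almost everywhere and [fine] alters it on a null set only. *)
Lemma is_density_fine d d1 (T : measurableType d) (T1 : measurableType d1)
    (R : realType) (P : probability T R) (mu : {measure set T1 -> \bar R})
    (X : T -> T1) (F : T1 -> \bar R) :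
  measurable_fun [set: T] X -> measurable_fun [set: T1] F ->
  (forall y, (0 <= F y)%E) ->
  (forall A, measurable A -> P (X @^-1` A) = \int[mu]_(y in A) F y)%E ->
  is_density P mu X (fine \o F).
Proof.
move=> mX mF F0 PF; split=> //.
- exact: (measurableT_comp (fine_measurable measurableT)).
- by move=> y; exact: fine_ge0.
- move=> A mA; rewrite PF//.
  have intF : mu.-integrable setT F.
    apply/integrableP; split=> //.
    under eq_integral do rewrite gee0_abs//.
    by rewrite -PF// preimage_setT probability_setT ltry.
  apply: ge0_ae_eq_integral => //.
  + exact: measurable_funTS.
  + apply/measurable_EFinP/measurable_funTS.
    exact: (measurableT_comp (fine_measurable measurableT)).
  + by move=> y _; rewrite lee_fin fine_ge0.
  + have := integrable_ae measurableT intF; apply: filterS => y /= /(_ I) fy _.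
    by rewrite fineK.
Qed.

(** This allows the stated density of u_N to be exchanged for its mixed form under an essential
    supremum. *)
Lemma is_density_ae_eq d d1 (T : measurableType d) (T1 : measurableType d1)
    (R : realType) (P : probability T R) (mu : {measure set T1 -> \bar R})
    (X : T -> T1) (f g : T1 -> R) :
  is_density P mu X f -> is_density P mu X g -> {ae mu, forall y, f y = g y}.
Proof.
move=> [mX mf f0 Pf] [_ mg g0 Pg].
have intf : mu.-integrable setT (EFin \o f).
  apply/integrableP; split; first exact/measurable_EFinP.
  under eq_integral do rewrite /= ger0_norm//.
  by rewrite -Pf// preimage_setT probability_setT ltry.
have /= : ae_eq mu setT (EFin \o f) (EFin \o g).
  apply: integral_ae_eq => //; first exact/measurable_EFinP.
  by move=> E _ mE; rewrite -Pf// -Pg.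
by apply: filterS => y /(_ I)[].
Qed.

(** The joint density lives on a product grouped to the left, while the affine substitution sets the
    first coordinate against the pair of the other two. *)
Lemma is_density_assoc d d1 d2 d3 (T : measurableType d)
    (T1 : measurableType d1) (T2 : measurableType d2) (T3 : measurableType d3)
    (R : realType) (P : probability T R)
    (m1 : {sigma_finite_measure set T1 -> \bar R})
    (m2 : {sigma_finite_measure set T2 -> \bar R})
    (m3 : {sigma_finite_measure set T3 -> \bar R})
    (X : T -> T1) (Y : T -> T2) (Z : T -> T3) (f : T1 * T2 * T3 -> R) :
  is_density P
    (sigma_finite_product m1 m2 \x m3)%E
    (fun w => (X w, Y w, Z w)) f ->
  is_density P
    (m1 \x sigma_finite_product m2 m3)%E
    (fun w => (X w, (Y w, Z w)))
    (fun z => f (z.1, z.2.1, z.2.2)).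
Proof.
pose h (z : T1 * (T2 * T3)) := (z.1, z.2.1, z.2.2).
pose k (z : T1 * T2 * T3) := (z.1.1, (z.1.2, z.2)).
have mh : measurable_fun setT h.
  apply/measurable_fun_pair; last first.
    exact: (measurableT_comp measurable_snd measurable_snd).
  apply/measurable_fun_pair => //.
  exact: (measurableT_comp measurable_fst measurable_snd).
have mk : measurable_fun setT k.
  apply/measurable_fun_pair.
    exact: (measurableT_comp measurable_fst measurable_fst).
  apply/measurable_fun_pair => //.
  exact: (measurableT_comp measurable_snd measurable_fst).
move=> [mXYZ mf f0 Pf]; split.
- exact: (measurableT_comp mk mXYZ).
- exact: (measurableT_comp mf mh).
- by move=> z; exact: f0.
move=> A mA.
have mkA : measurable (k @^-1` A) by rewrite -[X in measurable X]setTI; exact: mk.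
rewrite (_ : _ @^-1` A = (fun w => (X w, Y w, Z w)) @^-1` (k @^-1` A))// Pf//.
rewrite integral_mkcond [RHS]integral_mkcond.
pose F z := ((fun y => (f y)%:E) \_ (k @^-1` A)) z.
have mF : measurable_fun setT F.
  by apply/(measurable_restrictT _ mkA)/measurable_EFinP/measurable_funTS.
have F0 z : (0 <= F z)%E by apply: erestrict_ge0 => y _; rewrite lee_fin.
have FE z : ((fun z => (f (z.1, z.2.1, z.2.2))%:E) \_ A) z = F (h z).
  case: z => x [y z]; rewrite /F/= !patchE/=.
  by rewrite (_ : (_ \in k @^-1` A) = ((x, (y, z)) \in A)).
under [RHS]eq_integral do rewrite FE.
(* Both groupings lead to the same triple integral, with [m1] innermost and [m3] outermost. *)
rewrite [LHS](fubini_tonelli2 F)//.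
have mFh : measurable_fun setT (F \o h) by exact: measurableT_comp.
rewrite [RHS](fubini_tonelli2 (F \o h))//.
rewrite [RHS]fubini_tonelli2.
- apply: eq_integral => z _; rewrite /fubini_G. rewrite fubini_tonelli2//.
  by apply: (measurableT_comp mF); exact: measurable_fun_pair.
- by apply: measurable_fun_fubini_tonelli_G => // z; exact: F0.
- by move=> z; apply: integral_ge0 => x _; exact: F0.
- by move=> z; exact: F0.
Qed.

Lemma is_density_affine d d1 (T : measurableType d) (S : measurableType d1)
    (R : realType) (P : probability T R)
    (mu : {sigma_finite_measure set S -> \bar R})
    (Y : T -> measurableTypeR R) (Z : T -> S) (D : set S) (a b : S -> R)
    (g : measurableTypeR R * S -> R) :
  measurable D -> measurable_fun [set: S] a -> measurable_fun [set: S] b ->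
  (forall p, D p -> a p != 0) -> {ae P, forall w, D (Z w)} ->
  is_density P ((lebesgue_measure \x mu)%E :
      {measure set (measurableTypeR R * S) -> \bar R}) (fun w => (Y w, Z w)) g ->
  is_density P lebesgue_measure
    ((fun w => b (Z w) + a (Z w) * Y w) : T -> measurableTypeR R)
    (fun v => \int[mu]_(p in D) (g ((v - b p) / a p, p) / `|a p|)).
Proof.
move=> mD ma mb aD ZD [mYZ mg g0 Pg].
have mY : measurable_fun setT Y by exact: (measurableT_comp measurable_fst mYZ).
have mZ : measurable_fun setT Z by exact: (measurableT_comp measurable_snd mYZ).
have mX : measurable_fun setT
    ((fun w => b (Z w) + a (Z w) * Y w) : T -> measurableTypeR R).
  apply: measurable_funD; first exact: measurableT_comp.
  by apply: measurable_funM => //; exact: measurableT_comp.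
apply: is_density_fine => //.
- exact: measurable_fubini_affine.
- by move=> y; apply: integral_ge0 => p _; rewrite lee_fin divr_ge0.
move=> A mA.
(* The condition on [D] does not change the probability, since Z lies in [D] almost surely, and it
   confines the outer integral to nonzero slopes. *)
pose B : set (measurableTypeR R * S) :=
  [set z | D z.2 /\ A (b z.2 + a z.2 * z.1)].
have mB : measurable B.
  rewrite (_ : B = (snd @^-1` D) `&`
      ((fun z => b z.2 + a z.2 * z.1) : _ -> measurableTypeR R) @^-1` A)//.
  apply: measurableI.
    by rewrite -[X in measurable X]setTI; exact: measurable_snd.
  rewrite -[X in measurable X]setTI.
  suff : measurable_fun [set: measurableTypeR R * S]
      ((fun z => b z.2 + a z.2 * z.1) : _ -> measurableTypeR R) by exact.
  apply: measurable_funD.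
    by apply: measurableT_comp => //; exact: measurable_snd.
  apply: measurable_funM => //.
  by apply: measurableT_comp => //; exact: measurable_snd.
have mpre (C : set _) : measurable C -> measurable ((fun w => (Y w, Z w)) @^-1` C).
  by move=> mC; rewrite -[X in measurable X]setTI; exact: mYZ.
transitivity (P ((fun w => (Y w, Z w)) @^-1` B)).
  apply: ae_iff_measure_eq.
  - by rewrite -[X in measurable X]setTI; exact: mX.
  - exact: mpre.
  - by apply: filterS ZD => w DZ; split=> [|[]].
rewrite Pg// integral_mkcond fubini_tonelli2; last 2 first.
- by apply/(measurable_restrictT _ mB)/measurable_EFinP/measurable_funTS.
- by move=> z; apply: erestrict_ge0 => y _; rewrite lee_fin.
rewrite -fubini_affine// [RHS]integral_mkcond.
apply: eq_integral => p _; rewrite patchE /fubini_G; case: ifPn => pD.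
  apply: eq_integral => y _; rewrite patchE indicE.
  have -> : ((y, p) \in B) = (b p + a p * y \in A).
    by apply/idP/idP; rewrite !inE; [case|split=> //; rewrite inE in pD].
  by case: ifPn => _; rewrite ?mul1r ?mul0r.
apply: integral0_eq => y _; rewrite patchE ifF//; apply/negbTE.
by apply: contra pD; rewrite !inE => -[].
Qed.

(** For fixed [B], both sides are finite measures in [E]. They agree on rectangles, by two uses of
    the triple product rule (once with the full space in the middle), and rectangles form a
    generating class closed under intersection. *)
Lemma independent3_pair d d1 d2 d3 (T : measurableType d)
    (T1 : measurableType d1) (T2 : measurableType d2) (T3 : measurableType d3)
    (R : realType) (P : probability T R)
    (X : T -> T1) (Y : T -> T2) (Z : T -> T3) :
  measurable_fun [set: T] X -> measurable_fun [set: T] Y ->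
  measurable_fun [set: T] Z -> independent3 P X Y Z ->
  forall (B : set T2) (E : set (T3 * T1)), measurable B -> measurable E ->
    P (Y @^-1` B `&` (fun w => (Z w, X w)) @^-1` E) =
    (P (Y @^-1` B) * P ((fun w => (Z w, X w)) @^-1` E))%E.
Proof.
move=> mX mY mZ indep B E mB mE.
have mYB : measurable (Y @^-1` B).
  by rewrite -[X in measurable X]setTI; exact: mY.
have mZX : measurable_fun setT (fun w => (Z w, X w)).
  exact/measurable_fun_pair.
pose ZX : {mfun T >-> (T3 * T1)%type} := mfun_Sub (mem_set mZX).
have k0 : 0 <= fine (P (Y @^-1` B)) by rewrite fine_ge0.
pose k : {nonneg R} := NngNum k0.
have kE : k%:num%:E = P (Y @^-1` B) by rewrite fineK// fin_num_measure.
rewrite -kE setIC.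
pose C : set (set (T3 * T1)) :=
  [set D | exists2 A, measurable A & exists2 B, measurable B & A `*` B = D].
pose m1 := pushforward (mrestr P mYB) ZX.
pose m2 := mscale k (distribution P ZX).
suff : m1 E = m2 E by [].
apply: (@measure_unique _ _ _ C (fun=> setT)) => //.
- exact: measurable_prod_measurableType.
- move=> _ _ [A1 mA1 [B1 mB1 <-]] [A2 mA2 [B2 mB2 <-]]; rewrite -setXI.
  exists (A1 `&` A2); first exact: measurableI.
  by exists (B1 `&` B2) => //; exact: measurableI.
- by move=> _; exists setT => //; exists setT => //; rewrite setXTT.
- by rewrite bigcup_const.
- move=> _ [A mA [A' mA' <-]].
  transitivity (P (X @^-1` A' `&` Y @^-1` B `&` Z @^-1` A)).
    rewrite /m1 /= /pushforward /mrestr; congr (P _).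
    by apply/seteqP; split => w /= [[? ?] ?].
  transitivity (P (Y @^-1` B) * P (X @^-1` A' `&` Y @^-1` setT `&` Z @^-1` A))%E.
    rewrite !indep// preimage_setT probability_setT mule1.
    by rewrite muleA (muleC (P (Y @^-1` B))).
  rewrite -kE; congr (_ * P _)%E; rewrite preimage_setT setIT setIC.
  by apply/seteqP; split.
- move=> _; rewrite /m1/= /pushforward/= preimage_setT /mrestr setTI.
  by rewrite -ge0_fin_numE// fin_num_measure.
Qed.

(** The joint law is the product of the two laws, and only the first factor is rewritten with its
    density. Taking the law of [Z] as reference measure on [S] makes integrals over [S] expectations
    later on. *)
Lemma is_density_independent d d1 (T : measurableType d)
    (S : measurableType d1) (R : realType) (P : probability T R)
    (Y : T -> measurableTypeR R) (Z : {mfun T >-> S})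
    (f : measurableTypeR R -> R) :
  (forall B E, measurable B -> measurable E ->
    P (Y @^-1` B `&` Z @^-1` E) = (P (Y @^-1` B) * P (Z @^-1` E))%E) ->
  is_density P lebesgue_measure Y f ->
  is_density P ((lebesgue_measure \x distribution P Z)%E :
      {measure set (measurableTypeR R * S) -> \bar R}) (fun w => (Y w, Z w))
    (fun z => f z.1).
Proof.
move=> indep [mY mf f0 Pf].
have mYZ : measurable_fun setT (fun w => (Y w, Z w)).
  by apply/measurable_fun_pair => //; exact: measurable_funPT.
split => //.
- by apply: measurableT_comp => //; exact: measurable_fst.
pose Y' : {mfun T >-> measurableTypeR R} := mfun_Sub (mem_set mY).
pose YZ : {mfun T >-> (measurableTypeR R * S)%type} := mfun_Sub (mem_set mYZ).
move=> A mA.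
transitivity ((distribution P Y' \x distribution P Z)%E A).
  by apply/esym/(@product_measure_unique _ _ _ _ _ _ _ (distribution P YZ)).
have mF : measurable_fun setT
   ((fun z : measurableTypeR R * S => (f z.1)%:E) \_ A).
  apply/(measurable_restrictT _ mA)/measurable_EFinP/measurable_funTS.
  by apply: measurableT_comp => //; exact: measurable_fst.
have F0 z : (0 <= ((fun z : measurableTypeR R * S => (f z.1)%:E) \_ A) z)%E.
  by apply: erestrict_ge0 => y _; rewrite lee_fin.
rewrite [RHS]integral_mkcond [RHS]fubini_tonelli2// -[A in LHS]setIT.
rewrite -integral_indic// fubini_tonelli2//; last first.
  by apply/measurable_EFinP.
apply: eq_integral => z _; rewrite /fubini_G/=.
have mAz : measurable (ysection A z) by exact: measurable_ysection.
transitivity (\int[distribution P Y']_y (\1_(ysection A z) y)%:E)%E.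
  by apply: eq_integral => y _; rewrite !indicE mem_ysection.
rewrite integral_indic// setIT.
transitivity (\int[lebesgue_measure]_(y in ysection A z) (f y)%:E)%E.
  exact: Pf.
rewrite integral_mkcond; apply: eq_integral => y _.
by rewrite !patchE mem_ysection.
Qed.

(** * Convergence in probability *)

Lemma measurable_norm_ge d (T : measurableType d) (R : realType) (G : T -> R)
    (eta : R) :
  measurable_fun [set: T] G -> measurable [set w | eta <= `|G w|].
Proof.
move=> mG; rewrite (_ : [set w | _] = (Num.norm \o G) @^-1` `[eta, +oo[%classic).
  rewrite -[X in measurable X]setTI.
  have mnG : measurable_fun setT (Num.norm \o G) by exact: measurableT_comp.
  exact: mnG.
by apply/seteqP; split => w /=; rewrite in_itv/= andbT.
Qed.

Section convergence_in_probability.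
Context d (T : measurableType d) (R : realType) (P : probability T R).
Implicit Types (U V W : nat -> T -> R) (G : T -> R).

(* Convergence in probability, metrized by E[min(1, |W|)]. *)
Definition cvg0_prob W := forall e : R, 0 < e ->
  \forall n \near \oo, (\int[P]_w (Num.min 1 `|W n w|)%:E <= e%:E)%E.

Let min0 (r : R) : 0 <= Num.min 1 `|r|.
Proof. by rewrite le_min ler01/=. Qed.

Lemma measurable_min1_norm G : measurable_fun setT G ->
  measurable_fun setT (fun w => (Num.min 1 `|G w|)%:E).
Proof.
move=> mG; apply/measurable_EFinP/measurable_minr => //.
exact: measurableT_comp.
Qed.

(** Dominated convergence, with the truncation level 1 as dominating function. *)
Lemma cvg0_prob_ae W : (forall n, measurable_fun setT (W n)) ->
  {ae P, forall w, W n w @[n --> \oo] --> (0 : R)} -> cvg0_prob W.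
Proof.
move=> mW W0 e e0.
have min_cvg : {ae P, forall w, [set: T] w ->
    (Num.min 1 `|W n w|)%:E @[n --> \oo] --> (cst 0%E w : \bar R)}.
  apply: filterS W0 => w W0 _; apply: cvg_EFin; first exact: nearW.
  apply/cvgrPdist_le => /= eps eps0.
  move/cvgrPdist_le : W0 => /(_ _ eps0); apply: filterS => n.
  rewrite !sub0r !normrN => Wn; rewrite ger0_norm ?le_min ?ler01//=.
  by rewrite ge_min Wn orbT.
have int1 : P.-integrable setT (cst 1%E).
  by apply/integrableP; split => //; rewrite integral_cst//= normr1 mul1e
     probability_setT ltry.
have dom : {ae P, forall w n, [set: T] w ->
    (`|(Num.min 1 `|W n w|)%:E| <= cst 1%E w :> \bar R)%E}.
  apply: aeW => w n _; rewrite /= lee_fin (ger0_norm (min0 _)).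
  by rewrite ge_min lexx.
have [_ _] := @dominated_convergence _ _ _ P setT measurableT
  (fun n w => (Num.min 1 `|W n w|)%:E) (cst 0%E) (cst 1%E)
  (fun n => measurable_min1_norm (mW n)) (measurable_cst _) min_cvg int1 dom.
rewrite integral0 => /fine_cvgP[fin].
move=> /cvgrPdist_le/(_ _ e0) h; near=> n.
rewrite -[leLHS]fineK; last by near: n.
rewrite lee_fin (le_trans (ler_norm _))//.
have : `|0 - fine (\int[P]_w (Num.min 1 `|W n w|)%:E)%E| <= e.
  by near: n.
by rewrite sub0r normrN.
Unshelve. all: by end_near. Qed.

(** Truncation is subadditive: min(1, u + v) <= min(1, u) + min(1, v) for u, v >= 0. *)
Lemma cvg0_prob_leD U V W : (forall n, measurable_fun setT (U n)) ->
  (forall n, measurable_fun setT (V n)) ->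
  (forall n, measurable_fun setT (W n)) ->
  (forall n, {ae P, forall w, `|W n w| <= `|U n w| + `|V n w|}) ->
  cvg0_prob U -> cvg0_prob V -> cvg0_prob W.
Proof.
move=> mU mV mW WUV U0 V0 e e0; have e20 : 0 < e / 2 by rewrite divr_gt0.
have := U0 _ e20; have := V0 _ e20; apply: filterS2 => n Vn Un.
rewrite [e]splitr EFinD; apply: le_trans (leeD Un Vn).
rewrite -ge0_integralD//; try exact: measurable_min1_norm;
  try by move=> w _; rewrite lee_fin.
apply: ae_ge0_le_integral => //; try exact: measurable_min1_norm.
- by move=> w _; rewrite lee_fin.
- by apply: emeasurable_funD; exact: measurable_min1_norm.
apply: filterS (WUV n) => w WUVn _; rewrite -EFinD lee_fin.
have [U1|U1] := leP 1 `|U n w|.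
  by rewrite (le_trans (_ : _ <= 1)) ?ge_min ?lexx// lerDl.
have [V1|V1] := leP 1 `|V n w|.
  by rewrite (le_trans (_ : _ <= 1)) ?ge_min ?lexx// lerDr.
by rewrite ge_min WUVn orbT.
Qed.

(** [G] is finite but possibly not integrable. Where G > k the truncated product is at most 1, on an
    event that is unlikely for large k; elsewhere it is at most k |V n|. So k is fixed before n. *)
Lemma cvg0_prob_mulL1 G V : measurable_fun setT G ->
  (forall n, measurable_fun setT (V n)) -> (forall w, 0 <= G w) ->
  (forall e : R, 0 < e ->
    \forall n \near \oo, (\int[P]_w `|V n w|%:E <= e%:E)%E) ->
  cvg0_prob (fun n w => G w * V n w).
Proof.
move=> mG mV G0 V0 e e0; have e20 : 0 < e / 2 by rewrite divr_gt0.
have : cvg0_prob (fun k w => \1_[set w | k%:R < G w] w).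
  apply: cvg0_prob_ae => [k|].
    apply: measurable_indic; rewrite -[X in measurable X]setTI.
    by rewrite -preimage_itvoy; exact: mG.
  apply: aeW => w; apply: cvg_near_cst; near=> k; rewrite /= indicE memNset//=.
  apply/negP; rewrite -leNgt; near: k; exact: nbhs_infty_ger.
move=> /(_ _ e20)[k _ /(_ k.+1)/=]; rewrite leqnSn => /(_ isT) Gk.
have k0 : 0 < k.+1%:R :> R by rewrite ltr0n.
have := V0 _ (divr_gt0 e20 k0); apply: filterS => n Vn.
rewrite [e]splitr EFinD; have /(leeD Gk) : (k.+1%:R%:E *
    \int[P]_w `|V n w|%:E <= (e / 2)%:E)%E.
  by rewrite -lee_pdivlMl// muleC -EFinM.
apply: le_trans.
have mset : measurable [set w | k.+1%:R < G w].
  rewrite -[X in measurable X]setTI -preimage_itvoy; exact: mG.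
have mV' : measurable_fun setT (fun w => `|V n w|%:E).
  by apply/measurable_EFinP; exact: measurableT_comp.
have mI : measurable_fun setT
    (fun w => (Num.min 1 `|\1_[set w | k.+1%:R < G w] w : R|)%:E).
  by apply: measurable_min1_norm; exact: measurable_indic.
rewrite -ge0_integralZl//.
rewrite -ge0_integralD//; last by apply: emeasurable_funM.
apply: ge0_le_integral => //.
- by apply: measurable_min1_norm; exact: measurable_funM.
- by apply: emeasurable_funD => //; exact: emeasurable_funM.
move=> w _; rewrite -EFinM -EFinD lee_fin indicE.
have [kG|Gk'] := ltP k.+1%:R (G w).
  rewrite mem_set// normr1 minxx (le_trans (_ : _ <= 1)) ?ge_min ?lexx//.
  by rewrite lerDl mulr_ge0.
rewrite memNset/= ?normr0 ?[Num.min 1 0]min_r//; last by apply/negP; rewrite -leNgt.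
by rewrite add0r ge_min normrM (ger0_norm (G0 _)) ler_wpM2r ?orbT.
Unshelve. all: by end_near. Qed.

(** Markov's inequality for the truncated variable: it is at least min(1, eta) on the event. *)
Lemma cvg0_prob_tail W (eta : R) : (forall n, measurable_fun setT (W n)) ->
  cvg0_prob W -> 0 < eta -> forall e : R, 0 < e ->
  \forall n \near \oo, (P [set w | (eta <= `|W n w|)%R] <= e%:E)%E.
Proof.
move=> mW W0 eta0 e e0; have m0 : 0 < Num.min 1 eta by rewrite lt_min ltr01.
have := W0 _ (mulr_gt0 m0 e0); apply: filterS => n; rewrite EFinM => h.
rewrite -(@lee_pmul2l _ (Num.min 1 eta)%:E)//.
apply: le_trans h.
have mS := measurable_norm_ge eta (mW n).
rewrite -[X in P X]setIT -integral_indic// -ge0_integralZl//; last 2 first.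
- by apply/measurable_EFinP; exact: measurable_indic.
- by rewrite lee_fin ltW.
apply: ge0_le_integral => //.
- by move=> w _; rewrite -EFinM lee_fin mulr_ge0// ltW.
- by apply/measurable_EFinP/measurable_funM => //; exact: measurable_indic.
- exact: measurable_min1_norm.
move=> w _; rewrite -EFinM lee_fin indicE; have [|_] := boolP (w \in _).
  rewrite inE/= mulr1 => h; rewrite le_min !ge_min lexx/=.
  by rewrite h orbT.
by rewrite mulr0.
Qed.

End convergence_in_probability.

(** * Densities of affine combinations and their limits *)

(** On [y, y + 1] the density is at least f y - L, and its integral there is a probability; hence f
    y - L <= 1. *)
Lemma lipschitz_density_bounded d (T : measurableType d) (R : realType)
    (P : probability T R) (Y : T -> measurableTypeR R)
    (f : measurableTypeR R -> R) (L : R) :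
  is_density P lebesgue_measure Y f ->
  (forall s r : R, `|f s - f r| <= L * `|s - r|) -> forall y, f y <= 1 + L.
Proof.
move=> [mY mf f0 Pf] lip y; have L0 : 0 <= L.
  by have := le_trans (normr_ge0 _) (lip 1 0); rewrite subr0 normr1 mulr1.
rewrite -lerBlDr; have [fyL|fyL] := leP (f y - L) 0; first exact: le_trans ler01.
have mI : measurable (`[y, y + 1]%classic : set (measurableTypeR R)).
  exact: measurable_itv.
have : (P (Y @^-1` `[y, (y + 1)%R]) <= 1)%E.
  by apply: probability_le1; rewrite -[X in measurable X]setTI; exact: mY.
rewrite Pf// -lee_fin; apply: le_trans.
apply: (@le_trans _ _ (\int[lebesgue_measure]_(z in `[y, (y + 1)%R]) (f y - L)%:E)%E).
  rewrite integral_cst//= lebesgue_measure_itv/= lte_fin ltrDl ltr01.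
  by rewrite -EFinB [y + 1]addrC addrK mule1.
apply: ge0_le_integral => //.
- by move=> z _; rewrite lee_fin ltW.
- exact/measurable_EFinP/measurable_funTS.
move=> z /=; rewrite in_itv/= lee_fin => /andP[yz zy].
have := lip y z; rewrite ler_norml => /andP[_].
have : L * `|y - z| <= L by rewrite ler_piMr// ler_norml; apply/andP; split; lra.
lra.
Qed.

Lemma ae_bounded_integrable d (T : measurableType d) (R : realType)
    (P : probability T R) (h : T -> R) (M : R) : measurable_fun [set: T] h ->
  {ae P, forall w, `|h w| <= M} -> P.-integrable setT (EFin \o h).
Proof.
move=> mh hM; apply/integrableP; split; first exact/measurable_EFinP.
apply: (@le_lt_trans _ _ (\int[P]_w (Num.max 0 M)%:E)%E); last first.
  by rewrite integral_cst//= probability_setT mule1 ltry.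
apply: ae_ge0_le_integral => //.
- by apply/measurable_EFinP; exact: measurableT_comp.
- by move=> w _; rewrite lee_fin le_max lexx.
- by apply: filterS hM => w hM _ /=; rewrite lee_fin le_max hM orbT.
Qed.

Section mix_density.
Context d (T : measurableType d) (R : realType) (P : probability T R).
Variables (Y : T -> R) (f : R -> R) (B L C : R).
Hypotheses (mY : measurable_fun [set: T] Y) (mf : measurable_fun [set: R] f).
Hypotheses (f0 : forall y, 0 <= f y) (fB : forall y, f y <= B).
Hypothesis f_lip : forall s r : R, `|f s - f r| <= L * `|s - r|.
Hypothesis C0 : 0 < C.
Implicit Types A X : T -> R.

Let mix_fun A X v w := f ((v - X w) / A w + Y w) / `|A w|.

(* If X = b + A * Y, where Y has density f and is independent of (A, b), then
   the density of X at v is E[f((v - b) / A) / |A|]. Writing (v - b) / A as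
   (v - X) / A + Y makes it a function of A and X alone, so that it passes to
   the limit in (A, X) without any independence of the limits. *)
Definition mix_density A X (v : R) : R :=
  \int[P]_w (f ((v - X w) / A w + Y w) / `|A w|).

Let mix_fun_ge0 A X v w : 0 <= mix_fun A X v w.
Proof. by rewrite divr_ge0. Qed.

Let mix_fun_le A X v w : C <= `|A w| -> mix_fun A X v w <= B / C.
Proof.
move=> CA; apply: ler_pM => //.
by rewrite lef_pV2// posrE (lt_le_trans C0).
Qed.

Let measurable_mix_fun2 A X : measurable_fun setT A -> measurable_fun setT X ->
  measurable_fun [set: measurableTypeR R * T] (fun z => mix_fun A X z.1 z.2).
Proof.
move=> mA mX.
have mA2 : measurable_fun [set: measurableTypeR R * T] (fun z => A z.2).
  by apply: measurableT_comp => //; exact: measurable_snd.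
have mX2 : measurable_fun [set: measurableTypeR R * T] (fun z => X z.2).
  by apply: measurableT_comp => //; exact: measurable_snd.
have mY2 : measurable_fun [set: measurableTypeR R * T] (fun z => Y z.2).
  by apply: measurableT_comp => //; exact: measurable_snd.
apply: measurable_funM; last first.
  by apply: measurable_fun_inv; exact: measurableT_comp.
apply: (measurableT_comp mf); apply: measurable_funD => //.
apply: measurable_funM; last exact: measurable_fun_inv.
by apply: measurable_funB => //; exact: measurable_fst.
Qed.

Let measurable_mix_fun A X v : measurable_fun setT A -> measurable_fun setT X ->
  measurable_fun [set: T] (mix_fun A X v).
Proof.
move=> mA mX; apply: measurable_funM; last first.
  by apply: measurable_fun_inv; exact: measurableT_comp.
apply: (measurableT_comp mf); apply: measurable_funD => //.
apply: measurable_funM; last exact: measurable_fun_inv.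
exact: measurable_funB.
Qed.

Let integrable_mix_fun A X v : measurable_fun setT A -> measurable_fun setT X ->
  {ae P, forall w, C <= `|A w|} -> P.-integrable setT (EFin \o mix_fun A X v).
Proof.
move=> mA mX CA; apply: (@ae_bounded_integrable _ _ _ _ _ (B / C)).
  exact: measurable_mix_fun.
by apply: filterS CA => w CA; rewrite ger0_norm// mix_fun_le.
Qed.

Lemma mix_density_ge0 A X v : 0 <= mix_density A X v.
Proof. by apply: Rintegral_ge0 => w _; exact: mix_fun_ge0. Qed.

Lemma EFin_mix_density A X v :
  measurable_fun setT A -> measurable_fun setT X ->
  {ae P, forall w, C <= `|A w|} ->
  ((mix_density A X v)%:E = \int[P]_w (mix_fun A X v w)%:E)%E.
Proof.
by move=> mA mX CA; rewrite fineK//; apply: integrable_fin_num => //;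
   exact: integrable_mix_fun.
Qed.

Lemma mix_density_le A X v : measurable_fun setT A -> measurable_fun setT X ->
  {ae P, forall w, C <= `|A w|} -> mix_density A X v <= B / C.
Proof.
move=> mA mX CA; rewrite -lee_fin EFin_mix_density//.
apply: (@le_trans _ _ (\int[P]_w (B / C)%:E)%E); last first.
  by rewrite integral_cst//= probability_setT mule1.
apply: ae_ge0_le_integral => //.
- by move=> w _; rewrite lee_fin.
- exact/measurable_EFinP/measurable_mix_fun.
- by move=> w _; rewrite lee_fin divr_ge0 ?(ltW C0)// (le_trans (f0 0)).
- by apply: filterS CA => w CA _; rewrite lee_fin mix_fun_le.
Qed.

Lemma measurable_mix_density A X :
  measurable_fun setT A -> measurable_fun setT X ->
  measurable_fun [set: measurableTypeR R] (mix_density A X).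
Proof.
move=> mA mX.
apply: (@measurableT_comp _ _ _ _ _ _ fine); first exact: fine_measurable.
apply: (@measurable_fun_fubini_tonelli_F _ _ (measurableTypeR R) T R P
  (fun z => (mix_fun A X z.1 z.2)%:E)).
- by apply/measurable_EFinP; exact: measurable_mix_fun2.
- by move=> z; rewrite lee_fin.
Qed.

(** The first term serves when the truncation is active. The others bound the effect of changing, in
    this order, X inside [f], 1 / A inside [f], and the factor 1 / |A| outside. *)
Let K : R := 2 * (B / C) + L / C ^+ 2 + L / C ^+ 3 + B / C ^+ 2.

Let norm_inv_le (a : R) : C <= `|a| -> `|a^-1| <= C^-1.
Proof. by move=> Ca; rewrite normfV lef_pV2// posrE (lt_le_trans C0). Qed.

(** The variable Y cancels in the difference of the two arguments of [f]. In the weight of |A - A'|,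
    the part M + |X'| bounds |v - X'|, which multiplies 1/A - 1/A' in that difference, and the
    summand 1 pays for the change of the outer factor. The right-hand side is shaped as the
    integrand of [cvg0_prob]. *)
Let mix_fun_dist A X A' X' (M : R) v w : C <= `|A w| -> C <= `|A' w| ->
  `|v| <= M -> `|mix_fun A X v w - mix_fun A' X' v w| <=
  K * Num.min 1 `| `|X w - X' w| + (1 + M + `|X' w|) * `|A w - A' w| |.
Proof.
move=> CA CA' vM; have ha := mix_fun_le X v CA; have ha' := mix_fun_le X' v CA'.
rewrite /mix_fun in ha ha' *.
have := norm_inv_le CA; have := norm_inv_le CA'.
have a0 : A w != 0 by rewrite -normr_gt0 (lt_le_trans C0).
have a'0 : A' w != 0 by rewrite -normr_gt0 (lt_le_trans C0).
move: (A w) (A' w) (X w) (X' w) (Y w) a0 a'0 ha ha' => a a' x x' y a0 a'0.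
set s := (v - x) / a + y; set s' := (v - x') / a' + y => ha ha' ka' ka.
have k0 : 0 <= C^-1 by rewrite invr_ge0 ltW.
have KE : K = 2 * (B * C^-1) + L * C^-1 ^+ 2 + L * C^-1 ^+ 3 + B * C^-1 ^+ 2.
  by rewrite /K !exprVn.
have L0 : 0 <= L.
  by have := le_trans (normr_ge0 _) (f_lip 1 0); rewrite subr0 normr1 mulr1.
have B0 : 0 <= B by exact: le_trans (f0 0) (fB 0).
rewrite {}KE; move: (C^-1) k0 ka ka' ha ha' => k k0 ka ka' ha ha'.
have M0 : 0 <= M by exact: le_trans vM.
set W := `|x - x'| + _; have W0 : 0 <= W by rewrite addr_ge0// mulr_ge0// !addr_ge0.
rewrite (ger0_norm W0).
have Bk0 : 0 <= B * k by rewrite mulr_ge0.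
have Lk0 : 0 <= L * k ^+ 2 by rewrite mulr_ge0// exprn_ge0.
have Lk30 : 0 <= L * k ^+ 3 by rewrite mulr_ge0// exprn_ge0.
have Bk20 : 0 <= B * k ^+ 2 by rewrite mulr_ge0// exprn_ge0.
(* When the truncation is active it suffices that both values lie between 0 and B / C; the Lipschitz
   estimate is for the other case. *)
have [W1|W1] := leP 1 W.
  rewrite mulr1.
  have ga0 : 0 <= f s / `|a| by rewrite divr_ge0.
  have ga'0 : 0 <= f s' / `|a'| by rewrite divr_ge0.
  by rewrite ler_norml; apply/andP; split; lra.
have aa' : `|a^-1 - a'^-1| <= k ^+ 2 * `|a - a'|.
  have -> : a^-1 - a'^-1 = a^-1 * a'^-1 * (a' - a) by field; apply/andP.
  by rewrite !normrM [`|a' - a|]distrC ler_wpM2r// expr2 ler_pM.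
have ss' : `|s - s'| <= k * `|x - x'| + (M + `|x'|) * (k ^+ 2 * `|a - a'|).
  have -> : s - s' = a^-1 * (x' - x) + (v - x') * (a^-1 - a'^-1).
    by rewrite /s /s'; field; apply/andP.
  rewrite (le_trans (ler_normD _ _))// lerD//.
    by rewrite normrM [`|x' - x|]distrC ler_wpM2r.
  rewrite normrM ler_pM// (le_trans (ler_normB _ _))// lerD2r//.
have -> : f s / `|a| - f s' / `|a'| =
  (f s - f s') / `|a| + f s' * (`|a|^-1 - `|a'|^-1) by ring.
have t1 : `|(f s - f s') / `|a| | <=
    L * (k * `|x - x'| + (M + `|x'|) * (k ^+ 2 * `|a - a'|)) * k.
  rewrite normrM ler_pM//; last by rewrite normfV normr_id -normfV.
  by rewrite (le_trans (f_lip _ _))// ler_wpM2l.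
have t2 : `|f s' * (`|a|^-1 - `|a'|^-1)| <= B * (k ^+ 2 * `|a - a'|).
  rewrite normrM (ger0_norm (f0 _)) ler_pM//.
  rewrite -!normfV; apply: le_trans (ler_dist_dist _ _) _; exact: aa'.
rewrite (le_trans (ler_normD _ _))// (le_trans (lerD t1 t2))//.
rewrite /W; move: `|x - x'| `|a - a'| `|x'| (normr_ge0 (x - x'))
  (normr_ge0 (a - a')) (normr_ge0 x') => p q r p0 q0 r0.
have h1 : 0 <= p + (1 + M + r) * q by rewrite addr_ge0// mulr_ge0// !addr_ge0.
have h2 : 0 <= (M + r) * q by rewrite mulr_ge0// addr_ge0.
have -> : L * (k * p + (M + r) * (k ^+ 2 * q)) * k + B * (k ^+ 2 * q) =
  L * k ^+ 2 * p + L * k ^+ 3 * ((M + r) * q) + B * k ^+ 2 * q by ring.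
have e1 : L * k ^+ 2 * p <= L * k ^+ 2 * (p + (1 + M + r) * q).
  by rewrite ler_wpM2l// lerDl mulr_ge0// !addr_ge0.
have e2 : L * k ^+ 3 * ((M + r) * q) <= L * k ^+ 3 * (p + (1 + M + r) * q).
  by rewrite ler_wpM2l//; lra.
have e3 : B * k ^+ 2 * q <= B * k ^+ 2 * (p + (1 + M + r) * q).
  by rewrite ler_wpM2l//; lra.
have e4 : 0 <= B * k * (p + (1 + M + r) * q) by rewrite mulr_ge0.
lra.
Qed.

(** [K] is chosen before the random variables and before [v], and [v] enters the bound through [M]
    only: this is the source of uniformity on bounded sets. *)
Lemma mix_density_dist : exists2 K : R, 0 <= K & forall A X A' X' (M v : R),
  measurable_fun setT A -> measurable_fun setT X ->
  measurable_fun setT A' -> measurable_fun setT X' ->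
  {ae P, forall w, C <= `|A w|} -> {ae P, forall w, C <= `|A' w|} ->
  `|v| <= M ->
  (`|mix_density A X v - mix_density A' X' v|%:E <=
   K%:E * \int[P]_w (Num.min 1
     `| `|X w - X' w| + (1 + M + `|X' w|) * `|A w - A' w| |)%R%:E)%E.
Proof.
have K0 : 0 <= K.
  have L0 : 0 <= L.
    by have := le_trans (normr_ge0 _) (f_lip 1 0); rewrite subr0 normr1 mulr1.
  have B0 : 0 <= B by exact: le_trans (f0 0) (fB 0).
  have C0' := ltW C0.
  by repeat first [by [] | apply: addr_ge0 | apply: mulr_ge0 |
    rewrite invr_ge0 | apply: exprn_ge0].
exists K => // A X A' X' M v mA mX mA' mX' CA CA' vM.
have i1 := @integrable_mix_fun A X v mA mX CA.
have i2 := @integrable_mix_fun A' X' v mA' mX' CA'.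
rewrite /mix_density -RintegralB//.
have i3 : P.-integrable setT (EFin \o (mix_fun A X v \- mix_fun A' X' v)).
  exact: (integrableB measurableT i1 i2).
have mW : measurable_fun setT
    (fun w => `|X w - X' w| + (1 + M + `|X' w|) * `|A w - A' w|).
  apply: measurable_funD.
    by apply: measurableT_comp => //; exact: measurable_funB.
  apply: measurable_funM; last first.
    by apply: measurableT_comp => //; exact: measurable_funB.
  by apply: measurable_funD => //; exact: measurableT_comp.
rewrite EFin_normr_Rintegral//.
apply: (le_trans (le_abse_integral _ _ _)) => //.
  exact: measurable_int i3.
rewrite -ge0_integralZl//; last exact: measurable_min1_norm.
apply: ae_ge0_le_integral => //.
- by apply: measurableT_comp => //; exact: measurable_int i3.
- by move=> w _; rewrite mule_ge0// lee_fin// le_min ler01/=.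
- by apply: emeasurable_funM => //; exact: measurable_min1_norm.
apply: filterS2 CA CA' => w CA CA' _.
by rewrite -EFinM lee_fin; exact: mix_fun_dist.
Qed.

End mix_density.

Section integral_measure.
Local Open Scope ereal_scope.
Context d (T : measurableType d) (R : realType).
Variables (mu : {measure set T -> \bar R}) (f : T -> \bar R).

(** Measurability and nonnegativity are arguments, so that a measure structure can be attached to
    the set function itself. *)
Definition integral_measure (mf : measurable_fun [set: T] f)
  (f0 : forall x, 0 <= f x) : set T -> \bar R := fun A => \int[mu]_(x in A) f x.

Hypotheses (mf : measurable_fun [set: T] f) (f0 : forall x, 0 <= f x).

Let integral_measure0 : integral_measure mf f0 set0 = 0.
Proof. by rewrite /integral_measure integral_set0. Qed.

Let integral_measure_ge0 A : 0 <= integral_measure mf f0 A.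
Proof. by apply: integral_ge0 => x _; exact: f0. Qed.

Let integral_measure_sigma_additive :
  semi_sigma_additive (integral_measure mf f0).
Proof.
move=> F mF tF mUF; rewrite /integral_measure ge0_integral_bigcup//.
  apply: is_cvg_ereal_nneg_natsum_cond => n _ _.
  by apply: integral_ge0 => x _; exact: f0.
exact: measurable_funTS.
Qed.

HB.instance Definition _ := isMeasure.Build _ _ _ (integral_measure mf f0)
  integral_measure0 integral_measure_ge0 integral_measure_sigma_additive.

End integral_measure.

(** Half-open intervals generate the Borel sets and are closed under intersection, and the intervals
    ]-k, k] exhaust the line with finite mass; two measures that agree on them are equal. *)
Lemma is_density_ocitv d (T : measurableType d) (R : realType)
    (P : probability T R) (X : T -> measurableTypeR R)
    (f : measurableTypeR R -> R) :
  measurable_fun [set: T] X -> measurable_fun [set: measurableTypeR R] f ->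
  (forall y, 0 <= f y) ->
  (forall a b : R, P (X @^-1` `]a, b]) =
    \int[lebesgue_measure]_(y in `]a, b]) (f y)%:E)%E ->
  is_density P lebesgue_measure X f.
Proof.
move=> mX mf f0 PX; split => // A mA.
have mf' : measurable_fun setT (EFin \o f) by exact/measurable_EFinP.
have f0' y : (0 <= (EFin \o f) y)%E by rewrite lee_fin.
pose X' : {mfun T >-> measurableTypeR R} := mfun_Sub (mem_set mX).
suff : distribution P X' A = integral_measure lebesgue_measure mf' f0' A by [].
apply: (@measure_unique _ R (measurableTypeR R) (@ocitv R)
  (fun k => `](- k%:R)%R, k%:R]%classic) _ _ _ _ (distribution P X')
  (integral_measure lebesgue_measure mf' f0')) => //.
- exact: ocitvI.
- by move=> k; exists (- k%:R, k%:R).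
- rewrite -subTset => x _; exists (Num.bound `|x|) => //=.
  have := archi_boundP (normr_ge0 x); rewrite ltr_norml in_itv/=.
  by move=> /andP[-> /ltW].
- by move=> _ [[u v] _ <-]; exact: PX.
- move=> k; rewrite -ge0_fin_numE//; exact: fin_num_measure.
Qed.

(** The affine substitution is applied with the law of [Z] as reference measure, so that the
    resulting integral over [D] is an expectation. *)
Lemma is_density_mix d d1 (T : measurableType d) (S : measurableType d1)
    (R : realType) (P : probability T R)
    (Y : T -> measurableTypeR R) (Z : {mfun T >-> S}) (D : set S)
    (a b : S -> R) (f : measurableTypeR R -> R) :
  measurable D -> measurable_fun [set: S] a -> measurable_fun [set: S] b ->
  (forall p, D p -> a p != 0) -> {ae P, forall w, D (Z w)} ->
  (forall B E, measurable B -> measurable E ->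
    P (Y @^-1` B `&` Z @^-1` E) = (P (Y @^-1` B) * P (Z @^-1` E))%E) ->
  is_density P lebesgue_measure Y f ->
  is_density P lebesgue_measure
    ((fun w => b (Z w) + a (Z w) * Y w) : T -> measurableTypeR R)
    (mix_density P Y f (a \o Z) (fun w => b (Z w) + a (Z w) * Y w)).
Proof.
move=> mD ma mb aD ZD indep fY; have [mY mf f0 _] := fY.
have := is_density_affine mD ma mb aD ZD (is_density_independent indep fY).
congr is_density; apply/funext => v; congr fine.
pose F p : \bar R := (f ((v - b p) / a p) / `|a p|)%:E.
have mF : measurable_fun setT F.
  apply/measurable_EFinP/measurable_funM; last first.
    by apply: measurable_fun_inv; exact: measurableT_comp.
  apply: (measurableT_comp mf); apply: measurable_funM.
    exact: measurable_funB.
  exact: measurable_fun_inv.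
transitivity (\int[distribution P Z]_(p in D) F p)%E => //.
rewrite ge0_integral_pushforward//; last 2 first.
- exact: measurable_funTS.
- by move=> p _; rewrite lee_fin divr_ge0.
rewrite [LHS]integral_mkcond.
have mZD : measurable (Z @^-1` D).
  by rewrite -[X in measurable X]setTI; exact: measurable_funPT.
apply: ge0_ae_eq_integral => //.
- apply/(measurable_restrictT _ mZD)/measurable_funTS.
  exact: measurableT_comp.
- apply/measurable_EFinP/measurable_funM; last first.
    apply: measurable_fun_inv; apply: measurableT_comp => //.
    exact: measurableT_comp.
  apply: (measurableT_comp mf); apply: measurable_funD => //.
  apply: measurable_funM; last first.
    by apply: measurable_fun_inv; exact: measurableT_comp.
  apply: measurable_funB => //; apply: measurable_funD.
    exact: measurableT_comp.
  by apply: measurable_funM => //; exact: measurableT_comp.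
- by move=> w _; apply: erestrict_ge0 => y _; rewrite lee_fin divr_ge0.
- by move=> w _; rewrite lee_fin divr_ge0.
(* With X = b + a Y and a nonzero, (v - b) / a is the same as (v - X) / a + Y. *)
apply: filterS ZD => w Dw _; rewrite patchE mem_set//= /F.
have a0 := aD _ Dw; congr (f _ / _)%:E.
by field.
Qed.

Lemma probability_dist_le d (T : measurableType d) (R : realType)
    (P : probability T R) (E F G : set T) :
  measurable E -> measurable F -> measurable G ->
  E `<=` F `|` G -> F `<=` E `|` G ->
  `|fine (P E) - fine (P F)| <= fine (P G).
Proof.
move=> mE mF mG EFG FEG.
have h A B : measurable A -> measurable B -> A `<=` B `|` G ->
    fine (P A) <= fine (P B) + fine (P G).
  move=> mA mB AB; rewrite -fineD ?fin_num_measure//.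
  rewrite fine_le ?fin_numD ?fin_num_measure//.
  apply: (le_trans _ (measureU2 _ _ _)) => //.
  by apply: le_measure => //; rewrite inE//; exact: measurableU.
have := h _ _ mE mF EFG; have := h _ _ mF mE FEG.
by rewrite ler_norml => ? ?; apply/andP; split; lra.
Qed.

(** * Passage to the limit in the mixed densities *)

Section mix_density_limit.
Context d (T : measurableType d) (R : realType) (P : probability T R).
Variables (Y : T -> R) (f : R -> R) (B L C : R).
Hypotheses (mY : measurable_fun [set: T] Y) (mf : measurable_fun [set: R] f).
Hypotheses (f0 : forall y, 0 <= f y) (fB : forall y, f y <= B).
Hypothesis f_lip : forall s r : R, `|f s - f r| <= L * `|s - r|.
Hypothesis C0 : 0 < C.
Variables (A_ X_ : nat -> T -> R) (A X : T -> R).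
Hypotheses (mA_ : forall n, measurable_fun [set: T] (A_ n))
  (mX_ : forall n, measurable_fun [set: T] (X_ n)).
Hypotheses (mA : measurable_fun [set: T] A) (mX : measurable_fun [set: T] X).
Hypothesis CA_ : forall n, {ae P, forall w, C <= `|A_ n w|}.
Hypothesis A_cvg : {ae P, forall w, A_ n w @[n --> \oo] --> A w}.
Hypothesis X_cvg : cvg0_prob P (fun n w => X_ n w - X w).

Let CA : {ae P, forall w, C <= `|A w|}.
Proof.
have : {ae P, forall w n, C <= `|A_ n w|} by exact/ae_foralln.
apply: filterS2 A_cvg => w Aw CAw.
have nAw : `|A_ n w| @[n --> \oo] --> `|A w| by exact: cvg_norm.
rewrite -(cvg_lim (@Rhausdorff R) nAw).
by apply: limr_ge; [apply/cvg_ex; exists (`|A w|)|exact: nearW].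
Qed.

Lemma mix_density_cvg (M e : R) : 0 < e -> \forall n \near \oo, forall v,
  `|v| <= M ->
  `|mix_density P Y f (A_ n) (X_ n) v - mix_density P Y f A X v| <= e.
Proof.
have [K K0 dist] := mix_density_dist P mY mf f0 fB f_lip C0.
(* [K] may be 0, hence the division by K + 1. *)
move=> e0; have eK0 : 0 < e / (K + 1) by rewrite divr_gt0// ltr_wpDl.
have mA' n : measurable_fun setT (fun w => A_ n w - A w).
  exact: measurable_funB.
have mX' n : measurable_fun setT (fun w => X_ n w - X w).
  exact: measurable_funB.
have mV n : measurable_fun setT (fun w => (1 + M + `|X w|) * `|A_ n w - A w|).
  apply: measurable_funM; last exact: measurableT_comp.
  by apply: measurable_funD => //; exact: measurableT_comp.
have mW n : measurable_fun setT
   (fun w => `|X_ n w - X w| + (1 + M + `|X w|) * `|A_ n w - A w|).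
  by apply: measurable_funD => //; exact: measurableT_comp.
have V0 : cvg0_prob P (fun n w => (1 + M + `|X w|) * `|A_ n w - A w|).
  apply: cvg0_prob_ae => //; apply: filterS A_cvg => w Aw.
  rewrite -[X in _ --> X](mulr0 (1 + M + `|X w|)).
  apply: cvgM; first exact: cvg_cst.
  apply/norm_cvg0P; apply/subr_cvg0.
  exact: Aw.
have W0 := cvg0_prob_leD mX' mV mW _ X_cvg V0.
have : cvg0_prob P
    (fun n w => `|X_ n w - X w| + (1 + M + `|X w|) * `|A_ n w - A w|).
  apply: W0 => n; apply: aeW => w.
  by rewrite (le_trans (ler_normD _ _))// normr_id.
move=> /(_ _ eK0); apply: filterS => n W0n v vM.
rewrite -lee_fin (le_trans (dist _ _ _ _ M v _ _ _ _ _ _ _))//.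
apply: (@le_trans _ _ (K%:E * (e / (K + 1))%:E)%E).
  by rewrite lee_wpmul2l.
rewrite -EFinM lee_fin mulrA ler_pdivrMr ?ltr_wpDl//.
by rewrite mulrC ler_pM2l// lerDl.
Qed.

(** The events that X and X_n lie in ]a, b] differ only if |X_n - X| >= eta or X_n is within eta of
    an endpoint. The first has small probability for large n; the second has probability at most 4
    eta B / C, since B / C bounds every approximate density. *)
Lemma is_density_mix_limit :
  (forall n, is_density P lebesgue_measure (X_ n : T -> measurableTypeR R)
    (mix_density P Y f (A_ n) (X_ n))) ->
  is_density P lebesgue_measure (X : T -> measurableTypeR R)
    (mix_density P Y f A X).
Proof.
move=> dX.
have dle n v : mix_density P Y f (A_ n) (X_ n) v <= B / C.
  exact: mix_density_le.
have mg : measurable_fun [set: measurableTypeR R] (mix_density P Y f A X).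
  exact: measurable_mix_density.
have g0 v : 0 <= mix_density P Y f A X v by exact: mix_density_ge0.
apply: is_density_ocitv => // a b.
set g := mix_density P Y f A X in mg g0 *.
have BC0 : 0 <= B / C.
  by rewrite divr_ge0 ?(ltW C0)// (le_trans (f0 0)).
have gB v : g v <= B / C by exact: mix_density_le.
have lI (c e : R) : lebesgue_measure `]c, e]%classic =
    (Num.max 0 (e - c))%:E :> \bar R.
  rewrite lebesgue_measure_itv/= lte_fin; case: ltP => ce.
    by rewrite -EFinB max_r// subr_ge0 ltW.
  by rewrite max_l// subr_le0.
have iI (h : R -> R) (c e : R) : measurable_fun [set: measurableTypeR R] h ->
    (forall v, 0 <= h v) -> (forall v, h v <= B / C) ->
    lebesgue_measure.-integrable `]c, e] (EFin \o h).
  move=> mh h0 hB; apply: (@measurable_bounded_integrable _ (measurableTypeR R)).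
  - by [].
  - by have := lI c e; rewrite /= => ->; rewrite ltry.
  - exact: measurable_funTS.
  - exists (B / C); split; first exact: num_real.
    by move=> M BM y _ /=; rewrite ger0_norm// (le_trans (hB _))// ltW.
have mXI (Z : T -> R) c e : measurable_fun setT Z -> measurable (Z @^-1` `]c, e]).
  by move=> mZ; rewrite -[X in measurable X]setTI; exact: mZ.
have PE n c e : fine (P (X_ n @^-1` `]c, e])) =
    \int[lebesgue_measure]_(y in `]c, e]) mix_density P Y f (A_ n) (X_ n) y.
  by have [_ _ _ ->] := dX n.
have PB n c e : fine (P (X_ n @^-1` `]c, e])) <= B / C * Num.max 0 (e - c).
  rewrite PE; have [_ mgn gn0 _] := dX n.
  rewrite [leRHS](_ : _ = \int[lebesgue_measure]_(y in `]c, e]) (B / C)); last first.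
    rewrite Rintegral_cst//.
    by have := lI c e; rewrite /= => ->.
  apply: le_Rintegral => //; first exact: iI.
  by apply: iI => //; exact: measurable_cst.
suff : fine (P (X @^-1` `]a, b])) = \int[lebesgue_measure]_(y in `]a, b]) g y.
  move=> h; rewrite -[LHS]fineK ?fin_num_measure//; last exact: mXI.
  rewrite h /Rintegral fineK//; apply: integrable_fin_num => //.
  exact: iI.
apply/eqP; rewrite -subr_eq0 -normr_eq0; apply/eqP/le_anti.
rewrite normr_ge0 andbT; apply/ler_addgt0Pl => e e0; rewrite addr0.
(* Budget: e / 4 for the event |X_n - X| >= eta, e / 2 for the two endpoints, and e / 4 for the
   distance e' of the densities integrated over ]a, b]. The maximum with 0 covers b < a, where the
   interval is empty. *)
pose eta := e / (8 * (B / C + 1)).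
have eta0 : 0 < eta by rewrite divr_gt0// mulr_gt0// ltr_wpDl.
pose e' := e / (4 * (Num.max 0 (b - a) + 1)).
have m0 : 0 <= Num.max 0 (b - a) by rewrite le_max lexx.
have e'0 : 0 < e' by rewrite divr_gt0// mulr_gt0// ltr_wpDl.
have e40 : 0 < e / 4 by rewrite divr_gt0.
have mX' n : measurable_fun setT (fun w => X_ n w - X w).
  exact: measurable_funB.
near \oo => n.
have tail : (P [set w | (eta <= `|X_ n w - X w|)%R] <= (e / 4)%:E)%E.
  by near: n; exact: cvg0_prob_tail.
have close : forall v, `|v| <= `|a| + `|b| ->
    `|mix_density P Y f (A_ n) (X_ n) v - g v| <= e'.
  by near: n; exact: mix_density_cvg.
have mtail := measurable_norm_ge eta (mX' n).
pose G := [set w | (eta <= `|X_ n w - X w|)%R] `|`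
  (X_ n @^-1` `]a - eta, a + eta] `|` X_ n @^-1` `]b - eta, b + eta]).
have mG : measurable G.
  by apply: measurableU => //; apply: measurableU; exact: mXI.
have step1 : `|fine (P (X @^-1` `]a, b])) - fine (P (X_ n @^-1` `]a, b]))| <=
    fine (P G).
  apply: probability_dist_le => //; try exact: mXI.
  - move=> w; rewrite /G /= !in_itv/= => /andP[aX Xb].
    have [|X_lt] := leP eta `|X_ n w - X w|; first by right; left.
    move: X_lt; rewrite ltr_norml => /andP[? ?].
    have [X_a|X_a] := leP (X_ n w) a.
      by right; right; left; apply/andP; split; lra.
    have [X_b|X_b] := leP (X_ n w) b; first by left.
    by right; right; right; apply/andP; split; lra.
  - move=> w; rewrite /G /= !in_itv/= => /andP[aX Xb].
    have [|X_lt] := leP eta `|X_ n w - X w|; first by right; left.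
    move: X_lt; rewrite ltr_norml => /andP[? ?].
    have [X_a|X_a] := leP (X w) a.
      by right; right; left; apply/andP; split; lra.
    have [X_b|X_b] := leP (X w) b; first by left.
    by right; right; right; apply/andP; split; lra.
have step2 : fine (P G) <= e / 4 + (B / C * (2 * eta) + B / C * (2 * eta)).
  have h c : fine (P (X_ n @^-1` `]c - eta, c + eta])) <= B / C * (2 * eta).
    rewrite (le_trans (PB _ _ _))// ler_wpM2l// ge_max; apply/andP; split.
      by rewrite mulr_ge0// ltW.
    by rewrite le_eqVlt; apply/orP; left; apply/eqP; ring.
  rewrite -lee_fin fineK ?fin_num_measure//.
  apply: (le_trans (measureU2 _ _ _)) => //.
    by apply: measurableU; exact: mXI.
  rewrite EFinD leeD//.
  apply: (le_trans (measureU2 _ _ _)); try exact: mXI.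
  by rewrite EFinD leeD// -[leLHS]fineK ?lee_fin ?h// fin_num_measure//;
    exact: mXI.
have step3 : `|fine (P (X_ n @^-1` `]a, b])) -
    \int[lebesgue_measure]_(y in `]a, b]) g y| <= e / 4.
  have [_ mgn gn0 _] := dX n.
  have ign := iI _ a b mgn gn0 (dle n); have ig := iI _ a b mg g0 gB.
  rewrite PE -RintegralB//.
  apply: (le_trans (le_normr_Rintegral _ _)) => //.
    exact: (integrableB _ ign ig).
  apply: (@le_trans _ _ (\int[lebesgue_measure]_(y in `]a, b]) e')).
    apply: le_Rintegral => //.
    - have : lebesgue_measure.-integrable `]a, b]
        (EFin \o (mix_density P Y f (A_ n) (X_ n) \- g)).
        exact: (integrableB _ ign ig).
      by move/integrable_norm.
    - have -> : (EFin \o fun=> e') = (EFin \o cst e') by [].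
      apply: (@measurable_bounded_integrable _ (measurableTypeR R)) => //.
      + by have := lI a b; rewrite /= => ->; rewrite ltry.
      + exists e'; split; first exact: num_real.
        by move=> M e'M y _ /=; rewrite ger0_norm ltW.
    - move=> y /=; rewrite in_itv/= => /andP[ay yb]; apply: close.
      rewrite ler_norml.
      have := ler_norm a; have := ler_norm (- a); have := ler_norm b.
      have := ler_norm (- b); rewrite !normrN => ? ? ? ?.
      by apply/andP; split; lra.
  rewrite Rintegral_cst//; have := lI a b; rewrite /= => -> /=.
  rewrite /e' mulrAC ler_pdivrMr ?mulr_gt0// ?ltr_wpDl//.
  rewrite mulrA divfK// ler_pM2l//; lra.
have step4 : B / C * (2 * eta) + B / C * (2 * eta) <= e / 2.
  have -> : B / C * (2 * eta) + B / C * (2 * eta) = e / 2 * ((B / C) / (B / C + 1)).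
    rewrite /eta; move: BC0; move: (B / C) => q q0.
    by field; rewrite gt_eqF// ltr_wpDl.
  apply: ler_piMr; first by rewrite ltW// divr_gt0.
  by rewrite ler_pdivrMr ?ltr_wpDl// mul1r lerDl.
rewrite (le_trans (ler_distD (fine (P (X_ n @^-1` `]a, b]))) _ _))//.
lra.
Unshelve. all: by end_near. Qed.

End mix_density_limit.

(** * The heat series *)

Section heat_series.
Context {R : realType}.
Local Notation leb := (@lebesgue_measure R).
Local Notation L1_01 f := (leb.-integrable `[0%R, 1%R] (EFin \o f)).
Implicit Types (f g : R -> R) (x t a : R).

Let measurable_01 : measurable (`[0%R, 1%R]%classic : set (measurableTypeR R)).
Proof. exact: measurable_itv. Qed.

Lemma abs_sin_le1 (r : R) : `|sin r| <= 1.
Proof. by rewrite ler_norml sin_geN1 sin_le1. Qed.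

Lemma integrable_mul_sin f n :
  L1_01 f -> L1_01 (fun y => f y * sin (n%:R * pi * y)).
Proof.
move=> intf; have msin : measurable_fun (`[0, 1]%classic : set R)
    (fun y : R => sin (n%:R * pi * y)).
  apply: measurable_funTS; apply: measurableT_comp.
    by apply: continuous_measurable_fun; exact: continuous_sin.
  exact: measurable_funM.
have := @integrableMr _ _ _ leb _ measurable_01 _ _ msin _ intf.
have sinb : [bounded sin (n%:R * pi * y) | y in (`[0, 1]%classic : set R)].
  exists 1; split; first exact: num_real.
  by move=> M M1 y _ /=; rewrite (le_trans (abs_sin_le1 _))// ltW.
move=> /(_ sinb); apply: eq_integrable => // y _ /=.
by rewrite -EFinM mulrC.
Qed.

Lemma sin_coef_le f n : L1_01 f ->
  `|sin_coef f n| <= \int[leb]_(y in `[0, 1]) `|f y|.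
Proof.
move=> intf; have intfs := integrable_mul_sin n intf.
rewrite (le_trans (le_normr_Rintegral _ _))//.
apply: le_Rintegral => //.
- exact: (integrable_norm intfs).
- exact: (integrable_norm intf).
- by move=> y _; rewrite normrM ler_piMr// abs_sin_le1.
Qed.

Lemma sin_coefD f g n : L1_01 f -> L1_01 g ->
  sin_coef (fun y => f y + g y) n = sin_coef f n + sin_coef g n.
Proof.
move=> intf intg; rewrite /sin_coef -RintegralD//; try exact: integrable_mul_sin.
by apply: eq_Rintegral => y _; rewrite mulrDl.
Qed.

Lemma sin_coefZ f c n : L1_01 f ->
  sin_coef (fun y => c * f y) n = c * sin_coef f n.
Proof.
move=> intf; rewrite /sin_coef -RintegralZl//; last exact: integrable_mul_sin.
by apply: eq_Rintegral => y _; rewrite mulrA.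
Qed.

Lemma L1_01D f g : L1_01 f -> L1_01 g -> L1_01 (fun y => f y + g y).
Proof. by move=> intf intg; exact: (integrableD measurable_01 intf intg). Qed.

Lemma L1_01Z f c : L1_01 f -> L1_01 (fun y => c * f y).
Proof. by move=> intf; exact: (integrableZl measurable_01 c intf). Qed.

Lemma heat_sumD N f g x t a : L1_01 f -> L1_01 g ->
  heat_sum N (fun y => f y + g y) x t a = heat_sum N f x t a + heat_sum N g x t a.
Proof.
move=> intf intg; rewrite /heat_sum -big_split/=; apply: eq_bigr => n _.
by rewrite sin_coefD// !mulrDl.
Qed.

Lemma heat_sumZ N f c x t a : L1_01 f ->
  heat_sum N (fun y => c * f y) x t a = c * heat_sum N f x t a.
Proof.
move=> intf; rewrite /heat_sum big_distrr/=; apply: eq_bigr => n _.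
by rewrite sin_coefZ// !mulrA.
Qed.

Lemma L1_01_sum M (f_ : nat -> R -> R) : (forall m, L1_01 (f_ m)) ->
  L1_01 (fun y => \sum_(m < M) f_ m y).
Proof.
move=> intf; elim: M => [|M IH].
  under [X in integrable _ _ (_ \o X)]funext do rewrite big_ord0.
  exact: integrable0.
under [X in integrable _ _ (_ \o X)]funext do rewrite big_ord_recr/=.
exact: L1_01D.
Qed.

Lemma heat_sum_sum N M (f_ : nat -> R -> R) x t a : (forall m, L1_01 (f_ m)) ->
  heat_sum N (fun y => \sum_(m < M) f_ m y) x t a =
  \sum_(m < M) heat_sum N (f_ m) x t a.
Proof.
move=> intf; elim: M => [|M IH].
  rewrite big_ord0 /heat_sum big1// => n _.
  (* The empty sum is seen as a zero multiple of an integrable function, so that homogeneity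
     applies. *)
  have -> : (fun y => \sum_(m < 0) f_ m y) = (fun y => 0 * f_ 0 y).
    by apply/funext => y; rewrite big_ord0 mul0r.
  by rewrite sin_coefZ// !mul0r.
rewrite big_ord_recr/= -IH -heat_sumD//; last exact: L1_01_sum.
by congr heat_sum; apply/funext => y; rewrite big_ord_recr.
Qed.

(** The exponential factor of the term n = 1, which is the ratio of the dominating geometric
    series. *)
Definition heat_ratio t a : R := expR (- (pi ^+ 2 * a * t)).

Lemma heat_ratio_lt1 t a : 0 < t -> 0 < a -> heat_ratio t a < 1.
Proof.
by move=> t0 a0; rewrite expR_lt1 oppr_lt0 !mulr_gt0// pi_gt0.
Qed.

(** Since (n + 1)^2 >= n + 1, the exponential is at most q^(n+1) <= q^n, where q is the ratio. *)
Lemma heat_term_le f n x t a : 0 < t -> 0 < a -> L1_01 f ->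
  `|sin_coef f n.+1 * expR (- (n.+1%:R ^+ 2 * pi ^+ 2 * a * t))
    * sin (n.+1%:R * pi * x)| <=
  geometric (\int[leb]_(y in `[0, 1]) `|f y|) (heat_ratio t a) n.
Proof.
move=> t0 a0 intf; have q0 : 0 <= heat_ratio t a by exact: expR_ge0.
have q1 := heat_ratio_lt1 t0 a0; have I0 := sin_coef_le n.+1 intf.
rewrite normrM; apply: (@le_trans _ _ `|sin_coef f n.+1 *
    expR (- (n.+1%:R ^+ 2 * pi ^+ 2 * a * t))|).
  by rewrite ler_piMr// abs_sin_le1.
rewrite normrM /geometric/= ler_pM// ger0_norm ?expR_ge0//.
apply: (@le_trans _ _ (heat_ratio t a ^+ n.+1)); last first.
  by rewrite exprS ler_piMl// ?exprn_ge0// ltW.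
rewrite -expRM_natl ler_expR mulrN lerN2.
have -> : n.+1%:R * (pi ^+ 2 * a * t) = n.+1%:R * pi ^+ 2 * a * t :> R.
  by rewrite !mulrA.
rewrite !ler_wpM2r ?(ltW t0) ?(ltW a0) ?exprn_ge0 ?pi_ge0//.
by rewrite expr2 ler_pMr ?ltr0n// ler1n.
Qed.

Lemma heat_sumE N f x t a : heat_sum N f x t a =
  series (fun n => sin_coef f n.+1 * expR (- (n.+1%:R ^+ 2 * pi ^+ 2 * a * t))
    * sin (n.+1%:R * pi * x)) N.
Proof. by rewrite /heat_sum /series/= big_add1. Qed.

(** The full geometric sum makes the bound independent of [N], as is required when the number of
    terms grows together with the Karhunen-Loeve truncation. *)
Lemma heat_sum_le N f x t a : 0 < t -> 0 < a -> L1_01 f ->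
  `|heat_sum N f x t a| <=
  (\int[leb]_(y in `[0, 1]) `|f y|) / (1 - heat_ratio t a).
Proof.
move=> t0 a0 intf; have q1 := heat_ratio_lt1 t0 a0.
rewrite heat_sumE /series/= (le_trans (ler_norm_sum _ _ _))//.
set I := (\int[leb]_(y in `[0, 1]) _).
apply: (@le_trans _ _ (series (geometric I (heat_ratio t a)) N)).
  by apply: ler_sum => n _; exact: heat_term_le.
rewrite geometric_seriesE ?lt_eqF//= ler_pM2r ?invr_gt0 ?subr_gt0//.
rewrite ler_piMr ?Rintegral_ge0//.
by rewrite lerBlDr lerDl exprn_ge0 ?expR_ge0.
Qed.

Lemma is_cvg_heat_sum f x t a : 0 < t -> 0 < a -> L1_01 f ->
  cvgn (fun N => heat_sum N f x t a).
Proof.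
move=> t0 a0 intf; under eq_fun do rewrite heat_sumE.
apply: normed_cvg.
apply: (@series_le_cvg _ _
  (geometric (\int[leb]_(y in `[0, 1]) `|f y|) (heat_ratio t a))) => //.
- by move=> n /=.
- by move=> n; rewrite /geometric/= mulr_ge0 ?exprn_ge0 ?expR_ge0// Rintegral_ge0.
- by move=> n; exact: heat_term_le.
- apply: is_cvg_geometric_series.
  by rewrite ger0_norm ?expR_ge0// heat_ratio_lt1.
Qed.

Lemma measurable_heat_sum N f x t :
  measurable_fun [set: R] (fun a => heat_sum N f x t a).
Proof.
apply: measurable_sum => n; apply: measurable_funM => //.
apply: measurable_funM => //; apply: measurableT_comp => //.
apply: measurableT_comp => //; apply: measurable_funM => //.
Qed.

(** From |r| <= 1 + r^2 and the finite measure of [0, 1]. *)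
Lemma L2_01_integrable f : L2_01 f -> L1_01 f.
Proof.
move=> [mf f2]; have mf' : measurable_fun (`[0, 1]%classic : set R) (EFin \o f).
  exact/measurable_EFinP.
have mf2 : measurable_fun (`[0, 1]%classic : set R) (fun y => (f y ^+ 2)%:E).
  by apply/measurable_EFinP; exact: measurable_funX.
apply/integrableP; split => //.
apply: (@le_lt_trans _ _ (\int[leb]_(y in `[0%R, 1%R]) (1 + (f y ^+ 2)%:E))%E).
  apply: ge0_le_integral => //.
  - exact: measurableT_comp.
  - exact: emeasurable_funD.
  - move=> y _; rewrite /= -EFinD lee_fin ler_norml.
    by apply/andP; split; nra.
rewrite ge0_integralD//; last by move=> y _; rewrite lee_fin sqr_ge0.
rewrite integral_cst// lte_add_pinfty// mul1e/= lebesgue_measure_itv/=.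
by rewrite lte_fin ltr01 -EFinB ltry.
Qed.

End heat_series.

(** * Partial integrals *)

Section partial_integrals.
Local Open Scope ereal_scope.
Context d1 d2 (T1 : measurableType d1) (T2 : measurableType d2) (R : realType).
Variables (m1 : {sigma_finite_measure set T1 -> \bar R})
  (m2 : {sigma_finite_measure set T2 -> \bar R}) (D : set T1).
Hypothesis mD : measurable D.
Implicit Types F : T1 -> T2 -> \bar R.

(** Extension by zero: the process is measurable on [0, 1] x Omega only, while Tonelli's theorem is
    applied on a full product. *)
Let uncurry_restrict F (z : T1 * T2) : \bar R :=
  ((fun z => F z.1 z.2) \_ (D `*` setT)) z.

Let mDT : measurable (D `*` [set: T2]). Proof. exact: measurableX. Qed.

Let measurable_uncurry F :
  measurable_fun (D `*` setT) (fun z => F z.1 z.2) ->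
  measurable_fun setT (uncurry_restrict F).
Proof. by move=> mF; apply/(measurable_restrictT _ mDT). Qed.

Let uncurry_restrictE F y w : D y -> uncurry_restrict F (y, w) = F y w.
Proof. by move=> Dy; rewrite /uncurry_restrict patchE mem_set. Qed.

Let integral_uncurry F w :
  \int[m1]_y uncurry_restrict F (y, w) = \int[m1]_(y in D) F y w.
Proof.
rewrite [RHS]integral_mkcond; apply: eq_integral => y _.
rewrite /uncurry_restrict !patchE; congr (if _ then _ else _).
by apply/idP/idP; rewrite !inE => //= -[].
Qed.

Lemma measurable_section1 d' (S : measurableType d') (F : T1 -> T2 -> S) w :
  measurable_fun (D `*` setT) (fun z => F z.1 z.2) -> measurable_fun D (F ^~ w).
Proof.
move=> mF; apply: (@measurable_comp _ _ _ _ _ _ (D `*` setT)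
  (fun z => F z.1 z.2) D (fun y => (y, w))) => //.
- by move=> _ [y Dy <-].
- by apply: measurable_funTS; exact: measurable_fun_pair.
Qed.

Lemma measurable_section2 d' (S : measurableType d') (F : T1 -> T2 -> S) y :
  D y -> measurable_fun (D `*` setT) (fun z => F z.1 z.2) ->
  measurable_fun setT (F y).
Proof.
move=> Dy mF; apply: (@measurable_comp _ _ _ _ _ _ (D `*` setT)
  (fun z => F z.1 z.2) setT (fun w => (y, w))) => //.
- by move=> _ [w _ <-].
- exact: measurable_fun_pair.
Qed.

(** [F] may change sign. Positive and negative parts commute with taking sections, so Tonelli's
    theorem gives the measurability of each part. *)
Lemma measurable_integral1 F : measurable_fun (D `*` setT) (fun z => F z.1 z.2) ->
  measurable_fun setT (fun w => \int[m1]_(y in D) F y w).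
Proof.
move=> mF; have mF0 := measurable_uncurry mF.
have FE w : \int[m1]_(y in D) F y w =
    \int[m1]_y (uncurry_restrict F)^\+ (y, w) -
    \int[m1]_y (uncurry_restrict F)^\- (y, w).
  rewrite -integral_uncurry integralE.
  congr (_ - _); apply: eq_integral => z _; first by rewrite !funeposE.
  by rewrite !funenegE.
under eq_fun do rewrite FE.
apply: emeasurable_funB.
- apply: (@measurable_fun_fubini_tonelli_G _ _ T1 T2 R m1
    (funepos (uncurry_restrict F))) => //.
  exact: measurable_funepos.
- apply: (@measurable_fun_fubini_tonelli_G _ _ T1 T2 R m1
    (funeneg (uncurry_restrict F))) => //.
  exact: measurable_funeneg.
Qed.

Lemma measurable_integral2 F : measurable_fun (D `*` setT) (fun z => F z.1 z.2) ->
  measurable_fun D (fun y => \int[m2]_w F y w).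
Proof.
move=> mF; have mF0 := measurable_uncurry mF.
suff : measurable_fun D (fun y => \int[m2]_w uncurry_restrict F (y, w)).
  apply: eq_measurable_fun => y; rewrite inE => Dy.
  by apply: eq_integral => w _; rewrite uncurry_restrictE.
have FE y : \int[m2]_w uncurry_restrict F (y, w) =
    \int[m2]_w (uncurry_restrict F)^\+ (y, w) -
    \int[m2]_w (uncurry_restrict F)^\- (y, w).
  rewrite integralE; congr (_ - _); apply: eq_integral => z _.
    by rewrite !funeposE.
  by rewrite !funenegE.
apply: measurable_funTS; under eq_fun do rewrite FE.
apply: emeasurable_funB.
- apply: (@measurable_fun_fubini_tonelli_F _ _ T1 T2 R m2
    (funepos (uncurry_restrict F))) => //.
  exact: measurable_funepos.
- apply: (@measurable_fun_fubini_tonelli_F _ _ T1 T2 R m2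
    (funeneg (uncurry_restrict F))) => //.
  exact: measurable_funeneg.
Qed.

Lemma tonelli_partial F : measurable_fun (D `*` setT) (fun z => F z.1 z.2) ->
  (forall y w, D y -> 0 <= F y w) ->
  \int[m2]_w \int[m1]_(y in D) F y w = \int[m1]_(y in D) \int[m2]_w F y w.
Proof.
move=> mF F0; under eq_integral do rewrite -integral_uncurry.
rewrite -(fubini_tonelli (uncurry_restrict F)); last 2 first.
- exact: measurable_uncurry.
- by move=> z; apply: erestrict_ge0 => -[y w] [Dy _]; exact: F0.
rewrite [RHS]integral_mkcond; apply: eq_integral => y _.
rewrite patchE; case: ifPn => yD.
  by apply: eq_integral => w _; rewrite uncurry_restrictE//; rewrite inE in yD.
apply: integral0_eq => w _; rewrite /uncurry_restrict patchE ifF//.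
by apply/negbTE; apply: contra yD; rewrite !inE => -[].
Qed.

End partial_integrals.

(** The upper limit is defined everywhere and measurable, and it equals [g] almost everywhere;
    completeness transfers measurability to [g], whatever its values on the exceptional null set. *)
Lemma ae_cvg_measurable d (T : measurableType d) (R : realType)
    (P : {measure set T -> \bar R}) (h : nat -> T -> R) (g : T -> R) :
  measure_is_complete P -> (forall n, measurable_fun [set: T] (h n)) ->
  {ae P, forall w, h n w @[n --> \oo] --> g w} -> measurable_fun [set: T] g.
Proof.
move=> cP mh hg; apply/measurable_EFinP.
apply: (@ae_measurable_fun _ _ _ _ cP setT
  (fun w => limn_esup (fun n => (h n w)%:E))).
  apply: filterS hg => w hw _ /=.
  have hwE : (h n w)%:E @[n --> \oo] --> (g w)%:E.
    by apply: cvg_EFin => //; exact: nearW.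
  rewrite is_cvg_limn_esupE; first exact/cvg_lim.
  by apply/cvg_ex; exists (g w)%:E.
apply: measurable_fun_limn_esup => n; exact/measurable_EFinP.
Qed.

(** * Karhunen-Loeve partial sums *)

Section karhunen_loeve_heat.
Context d (T : measurableType d) (R : realType) (P : probability T R).
Local Notation leb := (@lebesgue_measure R).
Local Notation I01 := (`[0, 1]%classic : set R).
Local Notation L1_01 f := (leb.-integrable `[0%R, 1%R] (EFin \o f)).
Variables (phi : R -> T -> R) (nu : nat -> R) (phi_ : nat -> R -> R)
  (xi : nat -> {RV P >-> R}).
Hypotheses (hphi : L2_process P phi) (hKL : karhunen_loeve phi nu phi_ xi).

Definition kl_partial_sum (M : nat) (w : T) (y : R) : R :=
  mean P phi y + \sum_(m < M) Num.sqrt (nu m) * xi m w * phi_ m y.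

(** The L^1 distance, because [heat_sum] is bounded in terms of the L^1 norm of its datum. *)
Definition kl_error (M : nat) (w : T) : R :=
  \int[leb]_(y in `[0, 1]) `|phi y w - kl_partial_sum M w y|.

Let measurable_01 : measurable (I01 : set (measurableTypeR R)).
Proof. exact: measurable_itv. Qed.

Let mphi : measurable_fun
  ((I01 : set (measurableTypeR R)) `*` [set: T]) (fun p => phi p.1 p.2).
Proof. by case: hphi. Qed.

Let mEphi : measurable_fun
  ((I01 : set (measurableTypeR R)) `*` [set: T]) (fun p => (phi p.1 p.2)%:E).
Proof. by apply/measurable_EFinP; exact: mphi. Qed.

Let L1_01_phi_ m : L1_01 (phi_ m).
Proof. by have [e _ _] := kl_basis hKL; exact/L2_01_integrable/e. Qed.

Let measurable_phi w : measurable_fun I01 (phi ^~ w).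
Proof. exact: (measurable_section1 measurable_01 w mphi). Qed.

(** The squared L^2(0,1) norm of a path has finite expectation, so it is finite almost surely. *)
Lemma ae_L1_01_phi : {ae P, forall w, L1_01 (phi ^~ w)}.
Proof.
have mphi2 : measurable_fun
    ((I01 : set (measurableTypeR R)) `*` [set: T]) (fun p => (phi p.1 p.2 ^+ 2)%:E).
  by apply/measurable_EFinP; apply: measurable_funX; exact: mphi.
have := measurable_integral1 (F := fun y w => (phi y w ^+ 2)%:E)
  leb measurable_01 mphi2.
have F0 w : (0 <= \int[leb]_(y in `[0%R, 1%R]) ((phi y w) ^+ 2)%:E)%E.
  by apply: integral_ge0 => y _; rewrite lee_fin sqr_ge0.
move=> mF; have : P.-integrable setT
    (fun w => \int[leb]_(y in `[0%R, 1%R]) ((phi y w) ^+ 2)%:E)%E.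
  apply/integrableP; split => //.
  under eq_integral do rewrite gee0_abs//.
  by case: hphi.
move/(integrable_ae measurableT); apply: filterS => w /(_ I) fw.
apply: L2_01_integrable; split; first exact: measurable_phi.
by rewrite -ge0_fin_numE.
Qed.

Let measurable_mean : measurable_fun I01 (mean P phi).
Proof.
rewrite /mean unlock; apply: (@measurableT_comp _ _ _ _ _ _ fine).
  exact: fine_measurable.
exact: (measurable_integral2 (F := fun y w => (phi y w)%:E) P measurable_01 mEphi).
Qed.

Let integral_normr_phi : (\int[P]_w \int[leb]_(y in `[0%R, 1%R]) `|phi y w|%:E < +oo)%E.
Proof.
have [_ phi2] := hphi.
have mn : measurable_fun
    ((I01 : set (measurableTypeR R)) `*` [set: T]) (fun p => `|phi p.1 p.2|%:E).
  by apply/measurable_EFinP; apply: measurableT_comp => //; exact: mphi.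
have m2 : measurable_fun
    ((I01 : set (measurableTypeR R)) `*` [set: T]) (fun p => (phi p.1 p.2 ^+ 2)%:E).
  by apply/measurable_EFinP; apply: measurable_funX; exact: mphi.
have m1 := measurable_integral1 (F := fun y w => (phi y w ^+ 2)%:E)
  leb measurable_01 m2.
apply: (@le_lt_trans _ _ (\int[P]_w (1 + \int[leb]_(y in `[0%R, 1%R])
   ((phi y w) ^+ 2)%:E))%E).
  apply: ge0_le_integral => //.
  - by move=> w _; apply: integral_ge0 => y _; rewrite lee_fin.
  - exact: (measurable_integral1 (F := fun y w => `|phi y w|%:E) leb measurable_01 mn).
  - exact: emeasurable_funD.
  move=> w _; have -> : (1 = \int[leb]_(y in `[0%R, 1%R]) 1 :> \bar R)%E.
    rewrite integral_cst//= lebesgue_measure_itv/= lte_fin ltr01 mul1e.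
    by rewrite -EFinB subr0.
  rewrite -ge0_integralD//.
  - apply: ge0_le_integral => //.
    + exact: (measurable_section1 (F := fun y w => `|phi y w|%:E) measurable_01 w mn).
    + apply: emeasurable_funD => //.
      exact: (measurable_section1 (F := fun y w => (phi y w ^+ 2)%:E)
        measurable_01 w m2).
    + move=> y _; rewrite -EFinD lee_fin ler_norml.
      by apply/andP; split; nra.
  - by move=> y _; rewrite lee_fin sqr_ge0.
  - exact: (measurable_section1 (F := fun y w => (phi y w ^+ 2)%:E) measurable_01 w m2).
rewrite ge0_integralD//; last first.
  by move=> w _; apply: integral_ge0 => y _; rewrite lee_fin sqr_ge0.
by rewrite integral_cst//= probability_setT mul1e lte_add_pinfty ?ltry.
Qed.

(** |E[phi(y)]| <= E|phi(y)|, and Tonelli's theorem exchanges the expectation with the integral over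
    [0, 1]. *)
Lemma L1_01_mean : L1_01 (mean P phi).
Proof.
have mn : measurable_fun
    ((I01 : set (measurableTypeR R)) `*` [set: T]) (fun p => `|phi p.1 p.2|%:E).
  by apply/measurable_EFinP; apply: measurableT_comp => //; exact: mphi.
apply/integrableP; split; first exact/measurable_EFinP.
apply: le_lt_trans integral_normr_phi.
rewrite (tonelli_partial (F := fun y w => `|phi y w|%:E) leb P
  measurable_01 mn); last first.
  by move=> y w _; rewrite lee_fin.
apply: ge0_le_integral => //.
- apply: measurableT_comp => //; exact/measurable_EFinP.
- exact: (measurable_integral2 (F := fun y w => `|phi y w|%:E) P measurable_01 mn).
move=> y y01; rewrite /= /mean unlock.
have mphiy : measurable_fun setT (EFin \o phi y).
  exact: (measurable_section2 (F := fun y w => (phi y w)%:E) measurable_01 y01 mEphi).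
apply: (le_trans _ (le_abse_integral _ _ mphiy)) => //.
(* Where the expectation is infinite, [fine] returns 0 and the bound still holds. *)
by case: (\int[P]_w (EFin \o phi y) w)%E => [r| |] /=;
  rewrite ?normr0 ?leey.
Qed.

Lemma L1_01_kl_partial_sum M w : L1_01 (kl_partial_sum M w).
Proof.
apply: L1_01D; first exact: L1_01_mean.
apply: (@L1_01_sum _ _ (fun m y => Num.sqrt (nu m) * xi m w * phi_ m y)) => m.
  exact: L1_01Z.
Qed.

(** Linearity of [heat_sum] in its datum: u_N then differs from 2 T_N(phi) by the image of a single
    function, the remainder of the expansion. *)
Lemma heat_approxE alpha2 x t N w :
  heat_approx P phi nu phi_ xi alpha2 x t N w =
  2 * heat_sum N (kl_partial_sum N.-1 w) x t (alpha2 w).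
Proof.
rewrite /heat_approx -mulrDr; congr (2 * _).
rewrite heat_sumD; last 2 first.
- exact: L1_01_mean.
- apply: (@L1_01_sum _ _ (fun m y => Num.sqrt (nu m) * xi m w * phi_ m y)) => m.
  exact: L1_01Z.
rewrite (@heat_sum_sum _ _ _
  (fun m y => Num.sqrt (nu m) * xi m w * phi_ m y)); last by move=> m; exact: L1_01Z.
congr (_ + _); apply: eq_bigr => m _; rewrite heat_sumZ//.
ring.
Qed.

Let measurable_kl_partial_sum M : measurable_fun
  ((I01 : set (measurableTypeR R)) `*` [set: T])
  (fun p => kl_partial_sum M p.2 p.1).
Proof.
have m_fst (f : R -> R) : measurable_fun I01 f ->
    measurable_fun ((I01 : set (measurableTypeR R)) `*` [set: T]) (fun p => f p.1).
  move=> mf; apply: (@measurable_comp _ _ _ _ _ _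
    (I01 : set (measurableTypeR R)) f _ fst) => //.
  - by move=> _ [[y w] [? _] <-].
  - by apply: measurable_funTS; exact: measurable_fst.
apply: measurable_funD; first exact: m_fst.
apply: measurable_sum => m; apply: measurable_funM; last first.
  by apply: m_fst; have [e _ _] := kl_basis hKL; have [] := e m.
apply: measurable_funM => //; apply: measurable_funTS.
by apply: measurableT_comp => //; exact: measurable_snd.
Qed.

Let measurable_kl_diff M : measurable_fun
  ((I01 : set (measurableTypeR R)) `*` [set: T])
  (fun p => phi p.1 p.2 - kl_partial_sum M p.2 p.1).
Proof. by apply: measurable_funB; [exact: mphi|]. Qed.

Let measurable_kl_norm M : measurable_fun
  ((I01 : set (measurableTypeR R)) `*` [set: T])
  (fun p => `|phi p.1 p.2 - kl_partial_sum M p.2 p.1|%:E).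
Proof. by apply/measurable_EFinP; exact: measurableT_comp. Qed.

Lemma measurable_kl_error M : measurable_fun [set: T] (kl_error M).
Proof.
apply: (@measurableT_comp _ _ _ _ _ _ fine); first exact: fine_measurable.
exact: (measurable_integral1
  (F := fun y w => `|phi y w - kl_partial_sum M w y|%:E) leb measurable_01
  (measurable_kl_norm M)).
Qed.

Lemma kl_error_ge0 M w : 0 <= kl_error M w.
Proof. exact: Rintegral_ge0. Qed.

(** The inequality r <= e/2 + r^2 / (e/2) for r >= 0 takes the place of Cauchy-Schwarz. Integrated
    over [0, 1] x Omega, of total mass 1, it gives at most e once the mean square error is below
    (e/2)^2. *)
Lemma cvg_kl_error (e : R) : 0 < e ->
  \forall M \near \oo, (\int[P]_w `|kl_error M w|%:E <= e%:E)%E.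
Proof.
move=> e0; have e20 : 0 < e / 2 by rewrite divr_gt0.
have := kl_cvg hKL; rewrite (_ : 0%E = 0%R%:E)// => /fine_cvgP[fin cvg0].
have e40 : 0 < (e / 2) ^+ 2 by rewrite exprn_gt0.
near=> M.
pose D y w := phi y w - kl_partial_sum M w y.
have mD2 : measurable_fun
    ((I01 : set (measurableTypeR R)) `*` [set: T]) (fun p => (D p.1 p.2 ^+ 2)%:E).
  by apply/measurable_EFinP; apply: measurable_funX; exact: measurable_kl_diff.
have mI2 := measurable_integral1 (F := fun y w => (D y w ^+ 2)%:E)
  leb measurable_01 mD2.
have D2 : (\int[P]_w \int[leb]_(y in `[0%R, 1%R]) (D y w ^+ 2)%:E <=
    ((e / 2) ^+ 2)%:E)%E.
  have <- : (\int[P]_w \int[leb]_(y in `[0%R, 1%R])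
      ((phi y w - mean P phi y
        - \sum_(m < M) Num.sqrt (nu m) * phi_ m y * xi m w) ^+ 2)%:E =
      \int[P]_w \int[leb]_(y in `[0%R, 1%R]) (D y w ^+ 2)%:E)%E.
    apply: eq_integral => w _; apply: eq_integral => y _.
    rewrite /D /kl_partial_sum opprD addrA; congr ((_ - _) ^+ 2)%:E.
    by apply: eq_bigr => m _; rewrite mulrAC.
  rewrite -[leLHS]fineK; last by near: M.
  rewrite lee_fin (le_trans (ler_norm _))// -normrN -sub0r.
  by near: M; move/cvgrPdist_le : cvg0; exact.
apply: (@le_trans _ _ (\int[P]_w ((e / 2)%:E + (e / 2)^-1%:E *
    \int[leb]_(y in `[0%R, 1%R]) (D y w ^+ 2)%:E))%E).
  apply: ge0_le_integral => //.
  - apply/measurable_EFinP; apply: measurableT_comp => //.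
    exact: measurable_kl_error.
  - by apply: emeasurable_funD => //; exact: emeasurable_funM.
  move=> w _; apply: (@le_trans _ _ (\int[leb]_(y in `[0%R, 1%R]) `|D y w|%:E)%E).
    rewrite ger0_norm ?kl_error_ge0// /kl_error /Rintegral.
    (* If this integral is infinite, the error is 0 by the convention on [fine], and the inequality
       persists. *)
    have := @integral_ge0 _ _ R leb `[0%R, 1%R]%classic (fun y => `|D y w|%:E).
    move=> /(_ (fun y _ => normr_ge0 _)).
    rewrite /D; case: (\int[leb]_(y in _) _)%E => [r| |]//= _.
  have {1}-> : ((e / 2)%:E = \int[leb]_(y in `[0%R, 1%R]) (e / 2)%:E)%E.
    rewrite integral_cst//= lebesgue_measure_itv/= lte_fin ltr01.
    by rewrite -EFinB subr0 mule1.
  have mDw := measurable_section1 (F := fun y w => (D y w ^+ 2)%:E) measurable_01 w mD2.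
  rewrite -ge0_integralZl//; last 2 first.
  - by move=> y _; rewrite lee_fin sqr_ge0.
  - by rewrite lee_fin invr_ge0 ltW.
  have h0 : (0 <= (e / 2)%:E)%E by rewrite lee_fin ltW.
  have h1 y : (0 <= (e / 2)^-1%:E * (D y w ^+ 2)%:E)%E.
    by rewrite -EFinM lee_fin mulr_ge0 ?sqr_ge0// invr_ge0 ltW.
  have h2 : measurable_fun I01 (fun y => (e / 2)^-1%:E * (D y w ^+ 2)%:E)%E.
    exact: emeasurable_funM.
  rewrite -ge0_integralD//.
  apply: ge0_le_integral => //.
  - exact: (measurable_section1
      (F := fun y w => `|phi y w - kl_partial_sum M w y|%:E) measurable_01 w
      (measurable_kl_norm M)).
  - by apply: emeasurable_funD => //; exact: emeasurable_funM.
  - move=> y _; rewrite -EFinM -EFinD lee_fin -(ler_pM2l e20) mulrDr mulrA.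
    rewrite divff ?gt_eqF// mul1r -[D y w ^+ 2]real_normK ?num_real//.
    by move: `|D y w| => r; nra.
have h0 : (0 <= (e / 2)%:E)%E by rewrite lee_fin ltW.
have h1 w : (0 <= (e / 2)^-1%:E * \int[leb]_(y in `[0%R, 1%R]) (D y w ^+ 2)%:E)%E.
  rewrite mule_ge0 ?lee_fin ?invr_ge0 ?(ltW e20)//.
  by apply: integral_ge0 => y _; rewrite lee_fin sqr_ge0.
have h2 : measurable_fun setT (fun w => (e / 2)^-1%:E *
    \int[leb]_(y in `[0%R, 1%R]) (D y w ^+ 2)%:E)%E.
  exact: emeasurable_funM.
rewrite ge0_integralD//.
rewrite integral_cst//= probability_setT mule1 [in leRHS](splitr e) EFinD leeD//.
rewrite ge0_integralZl//; last 2 first.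
- by move=> w _; apply: integral_ge0 => y _; rewrite lee_fin sqr_ge0.
- by rewrite lee_fin invr_ge0 ltW.
apply: (@le_trans _ _ ((e / 2)^-1%:E * ((e / 2) ^+ 2)%:E)%E).
  by rewrite lee_wpmul2l// lee_fin invr_ge0 ltW.
by rewrite -EFinM lee_fin expr2 mulKf ?gt_eqF.
Unshelve. all: by end_near. Qed.

End karhunen_loeve_heat.

(** * Convergence in probability of the approximations *)

Section heat_convergence.
Context d (T : measurableType d) (R : realType) (P : probability T R).
Local Notation leb := (@lebesgue_measure R).
Local Notation I01 := (`[0, 1]%classic : set R).
Local Notation L1_01 f := (leb.-integrable `[0%R, 1%R] (EFin \o f)).
Variables (phi : R -> T -> R) (nu : nat -> R) (phi_ : nat -> R -> R)
  (xi : nat -> {RV P >-> R}) (alpha2 : {RV P >-> R}) (x t : R).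
Hypotheses (hphi : L2_process P phi) (hKL : karhunen_loeve phi nu phi_ xi).
Hypotheses (cP : measure_is_complete P) (t0 : 0 < t).
Hypothesis alpha_gt0 : {ae P, forall w, 0 < alpha2 w}.

(** The partial sums of the series u, intermediate between u_N and u. *)
Let heat_trunc N w := 2 * heat_sum N (phi ^~ w) x t (alpha2 w).

Let measurable_01 : measurable (I01 : set (measurableTypeR R)).
Proof. exact: measurable_itv. Qed.

Let measurable_sin_coef n : measurable_fun [set: T] (fun w => sin_coef (phi ^~ w) n).
Proof.
have [mphi _] := hphi.
apply: (@measurableT_comp _ _ _ _ _ _ fine); first exact: fine_measurable.
apply: (measurable_integral1 (F := fun y w => (phi y w * sin (n%:R * pi * y))%:E)
  leb measurable_01).
apply/measurable_EFinP; apply: measurable_funM; first exact: mphi.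
apply: measurable_funTS; apply: measurableT_comp.
  by apply: continuous_measurable_fun; exact: continuous_sin.
by apply: measurable_funM => //; exact: measurable_fst.
Qed.

Let measurable_heat_trunc N : measurable_fun [set: T] (heat_trunc N).
Proof.
apply: measurable_funM => //; apply: measurable_sum => n.
apply: measurable_funM => //; apply: measurable_funM => //.
apply: measurableT_comp => //; apply: measurableT_comp => //.
by apply: measurable_funM => //; apply: measurable_funM.
Qed.

Let heat_trunc_cvg : {ae P, forall w,
  heat_trunc N w @[N --> \oo] --> heat_solution phi alpha2 x t w}.
Proof.
apply: filterS2 (ae_L1_01_phi hphi) alpha_gt0 => w phiw aw.
have cvg_trunc : cvgn (heat_trunc ^~ w).
  by apply: is_cvgM; [exact: is_cvg_cst|exact: is_cvg_heat_sum].
suff -> : heat_solution phi alpha2 x t w = limn (heat_trunc ^~ w) by [].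
rewrite /heat_solution; congr (limn _); apply/funext => N.
rewrite /heat_trunc /heat_sum big_distrr/=; apply: eq_bigr => n _.
by rewrite !mulrA.
Qed.

Lemma measurable_heat_solution :
  measurable_fun [set: T] (heat_solution phi alpha2 x t).
Proof. exact: (ae_cvg_measurable cP measurable_heat_trunc heat_trunc_cvg). Qed.

Lemma measurable_heat_approx N :
  measurable_fun [set: T] (heat_approx P phi nu phi_ xi alpha2 x t N).
Proof.
have mhs f : measurable_fun setT (fun w => heat_sum N f x t (alpha2 w)).
  by apply: measurableT_comp => //; exact: measurable_heat_sum.
apply: measurable_funD; first exact: measurable_funM.
apply: measurable_funM => //; apply: measurable_sum => m.
by apply: measurable_funM => //; exact: measurable_funM.
Qed.

(** The distance from u_N to the partial sum of u is at most 2 / (1 - q) times the L^1 error of the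
    expansion, a finite factor times a sequence tending to 0 in mean; the partial sums converge
    almost surely. The shift by 3 keeps every index in the range N >= 3. *)
Lemma heat_approx_cvg0_prob : cvg0_prob P (fun n w =>
  heat_approx P phi nu phi_ xi alpha2 x t (n + 3) w
  - heat_solution phi alpha2 x t w).
Proof.
(* The absolute value makes the factor nonnegative also on the null set where alpha^2 <= 0. *)
pose G w : R := `|2 / (1 - heat_ratio t (alpha2 w))|.
have mG : measurable_fun setT G.
  apply: measurableT_comp => //; apply: measurable_funM => //.
  apply: measurable_fun_inv; apply: measurable_funB => //; rewrite /heat_ratio.
  apply: measurableT_comp => //; apply: measurableT_comp => //.
  by apply: measurable_funM => //; apply: measurable_funM.
have mV n : measurable_fun setT (kl_error phi nu phi_ xi (n + 3).-1).
  exact: measurable_kl_error.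
apply: (@cvg0_prob_leD _ _ _ _
  (fun n w => heat_trunc (n + 3) w - heat_solution phi alpha2 x t w)
  (fun n w => G w * kl_error phi nu phi_ xi (n + 3).-1 w)).
- move=> n; apply: measurable_funB => //; exact: measurable_heat_solution.
- by move=> n; exact: measurable_funM.
- move=> n; apply: measurable_funB; first exact: measurable_heat_approx.
  exact: measurable_heat_solution.
- move=> n; apply: filterS2 (ae_L1_01_phi hphi) alpha_gt0 => w phiw aw.
  have hdist : `|heat_approx P phi nu phi_ xi alpha2 x t (n + 3) w -
      heat_trunc (n + 3) w| <= G w * kl_error phi nu phi_ xi (n + 3).-1 w.
    rewrite (heat_approxE hphi hKL) /heat_trunc -mulrBr normrM distrC.
    have kl_int := L1_01_kl_partial_sum hphi hKL (n + 3).-1 w.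
    have dint : L1_01 (fun y => phi y w -
        kl_partial_sum phi nu phi_ xi (n + 3).-1 w y).
      exact: (integrableB measurable_01 phiw kl_int).
    have -> : heat_sum (n + 3) (phi ^~ w) x t (alpha2 w) -
        heat_sum (n + 3) (kl_partial_sum phi nu phi_ xi (n + 3).-1 w)
          x t (alpha2 w) =
        heat_sum (n + 3) (fun y => phi y w -
          kl_partial_sum phi nu phi_ xi (n + 3).-1 w y) x t (alpha2 w).
      apply/eqP; rewrite subr_eq -heat_sumD//; apply/eqP; congr heat_sum.
      by apply/funext => y; rewrite subrK.
    have := heat_sum_le (n + 3) x t0 aw dint.
    rewrite /G normrM ger0_norm// [`|_^-1|]ger0_norm; last first.
      by rewrite invr_ge0 subr_ge0 ltW// heat_ratio_lt1.
    by move=> h; rewrite -mulrA ler_wpM2l// mulrC.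
  rewrite -[X in `|X|](subrKA (heat_trunc (n + 3) w)) addrC.
  rewrite (le_trans (ler_normD _ _))// lerD2l (le_trans hdist)//.
  exact: ler_norm.
- apply: cvg0_prob_ae => [n|].
    apply: measurable_funB => //; exact: measurable_heat_solution.
  apply: filterS heat_trunc_cvg => w hw; apply/subr_cvg0.
  by rewrite (@cvg_shiftn 3 _ (heat_trunc ^~ w)).
- apply: cvg0_prob_mulL1 => // [w|e e0]; first exact: normr_ge0.
  have [N _ hN] := cvg_kl_error hphi hKL e0.
  exists N; first by [].
  move=> n Nn; have n3 : (n <= (n + 3).-1)%N by rewrite addnS leq_addr.
  exact: (hN (n + 3).-1 (leq_trans Nn n3)).
Qed.

End heat_convergence.

(** * The approximate densities *)

Lemma ge0_cvge0 (R : realType) (u : nat -> \bar R) :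
  (forall n, (0 <= u n)%E) ->
  (forall e : R, 0 < e -> \forall n \near \oo, (u n <= e%:E)%E) ->
  u n @[n --> \oo] --> 0%E.
Proof.
move=> u0 ue; apply/fine_cvgP; split.
  apply: filterS (ue 1 ltr01) => n un1.
  by rewrite ge0_fin_numE// (le_lt_trans un1)// ltry.
apply/cvgrPdist_le => e e0; apply: filterS (ue e e0) => n une.
rewrite sub0r normrN ger0_norm ?fine_ge0//= -lee_fin fineK//.
by rewrite ge0_fin_numE// (le_lt_trans une)// ltry.
Qed.

Lemma Lnorm_pinfty_le d (T : measurableType d) (R : realType)
    (mu : {measure set T -> \bar R}) (f : T -> \bar R) (e : R) : 0 <= e ->
  {ae mu, forall y, (`|f y| <= e%:E)%E} -> ('N[mu]_+oo[f] <= e%:E)%E.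
Proof.
move=> e0 fe; rewrite unlock; case: ifPn => _; last by rewrite lee_fin.
exact/ess_supP.
Qed.

Lemma measurable_heat_dom (R : realType) N (f : R -> R) (x t : R) :
  measurable (heat_dom N f x t : set (measurableTypeR R)).
Proof.
rewrite (_ : heat_dom N f x t = `]0, +oo[%classic `&`
    (fun a => heat_sum N f x t a) @^-1` (~` [set 0])); last first.
  by apply/seteqP; split => a /= [a0 /eqP aN]; split => //;
    rewrite in_itv/= andbT in a0 *.
apply: measurableI; first exact: measurable_itv.
rewrite -[X in measurable X]setTI; apply: measurable_heat_sum => //.
exact: measurableC.
Qed.

(** [lipschitz] provides a threshold beyond which every number is a Lipschitz constant; one past the
    threshold is taken. *)
Lemma lipschitzP_norm (R : realType) (f : R -> R) : lipschitz f ->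
  exists L : R, forall s r : R, `|f s - f r| <= L * `|s - r|.
Proof.
move=> [M [_ fM]]; exists (M + 1) => s r.
by apply: (fM (M + 1) _ (s, r)) => //; rewrite ltrDl.
Qed.

Section heat_density.
Context d (T : measurableType d) (R : realType) (P : probability T R).
Variables (phi : R -> T -> R) (nu : nat -> R) (phi_ : nat -> R -> R)
  (xi : nat -> {RV P >-> R}) (alpha2 : {RV P >-> R}) (x t C : R).
Hypotheses (nu0 : 0 < nu 0%N) (C0 : 0 < C).
Hypothesis alpha_gt0 : {ae P, forall w, 0 < alpha2 w}.
Hypothesis heat_sum_bound : {ae P, forall w, forall N, (1 <= N)%N ->
  C <= `|heat_sum N (phi_ 0%N) x t (alpha2 w)|}.

Let mR := measurableTypeR R.

(* heat_approx N = shift N p + slope N p * xi 0 at p = (xi_tail xi N, alpha2). *)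
Definition slope N (p : vec R (N - 2) * mR) : R :=
  2 * Num.sqrt (nu 0%N) * heat_sum N (phi_ 0%N) x t p.2.

Definition shift N (p : vec R (N - 2) * mR) : R :=
  2 * (heat_sum N (mean P phi) x t p.2 + \sum_(i < N - 2)
    heat_sum N (phi_ i.+1) x t p.2 * Num.sqrt (nu i.+1) * tnth p.1 i).

Definition tail_alpha N (w : T) : vec R (N - 2) * mR :=
  (xi_tail xi N w, alpha2 w).

Lemma measurable_xi_tail N : measurable_fun [set: T] (xi_tail xi N).
Proof.
apply/measurable_fun_tnthP => i; rewrite /xi_tail.
have -> : (@tnth _ _)^~ i \o (fun w => [tuple xi (val i).+1 w | i < N - 2]) =
    xi (val i).+1 by apply/funext => w /=; rewrite tnth_mktuple.
exact: (measurable_funPT (xi (val i).+1)).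
Qed.

Lemma measurable_tail_alpha N : measurable_fun [set: T] (@tail_alpha N).
Proof.
apply/measurable_fun_pair; first exact: measurable_xi_tail.
exact: (measurable_funPT alpha2).
Qed.

Lemma measurable_slope N : measurable_fun setT (@slope N).
Proof.
apply: measurable_funM => //.
apply: (measurableT_comp (measurable_heat_sum N (phi_ 0%N) x t)).
exact: measurable_snd.
Qed.

Lemma measurable_shift N : measurable_fun setT (@shift N).
Proof.
have mhs f : measurable_fun setT (fun p : vec R (N - 2) * mR => heat_sum N f x t p.2).
  apply: (measurableT_comp (measurable_heat_sum N f x t)).
  exact: measurable_snd.
apply: measurable_funM => //; apply: measurable_funD => //.
apply: measurable_sum => i; apply: measurable_funM; first exact: measurable_funM.
apply: (@measurableT_comp _ _ _ _ _ _ (fun v : vec R (N - 2) => tnth v i)).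
  exact: measurable_tnth.
exact: measurable_fst.
Qed.

Definition tail_alpha_dom N : set (vec R (N - 2) * mR) :=
  setT `*` heat_dom N (phi_ 0%N) x t.
Arguments tail_alpha_dom : clear implicits.

Lemma measurable_tail_alpha_dom N : measurable (tail_alpha_dom N).
Proof. by apply: measurableX => //; exact: measurable_heat_dom. Qed.

Lemma slope_neq0 N p : tail_alpha_dom N p -> slope p != 0.
Proof.
move=> [_ [_ h]]; rewrite mulf_neq0// mulf_neq0// ?pnatr_eq0//.
by rewrite gt_eqF// sqrtr_gt0.
Qed.

Lemma ae_tail_alpha_dom N : (1 <= N)%N ->
  {ae P, forall w, tail_alpha_dom N (tail_alpha N w)}.
Proof.
move=> N1; apply: filterS2 alpha_gt0 heat_sum_bound => w aw bw.
split => //; split => //=.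
by rewrite -normr_gt0 (lt_le_trans C0)// bw.
Qed.

Lemma heat_approx_affine N w : (3 <= N)%N ->
  heat_approx P phi nu phi_ xi alpha2 x t N w =
  shift (tail_alpha N w) + slope (tail_alpha N w) * xi 0%N w.
Proof.
move=> N3; rewrite /heat_approx /shift /slope /=.
(* The sum has N - 1 terms; the one of index 0 carries xi_1, and N - 2 remain for the tail
   vector. *)
have -> : N.-1 = (N - 2).+1 by move: N3; case: N => [|[|[|N]]] //; rewrite subn2.
rewrite big_ord_recl /= mulrDr; set S := \sum_(i < N - 2) _.
have -> : \sum_(i < N - 2) heat_sum N (phi_ i.+1) x t (alpha2 w) *
    Num.sqrt (nu i.+1) * tnth (xi_tail xi N w) i = S.
  by apply: eq_bigr => i _; rewrite tnth_mktuple.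
ring.
Qed.

Lemma is_density_heat_approx_density N
    (fj : mR * vec R (N - 2) * mR -> R) : (3 <= N)%N ->
  is_density P (lebesgue_joint R N) (joint_vector xi alpha2 N) fj ->
  is_density P lebesgue_measure (heat_approx P phi nu phi_ xi alpha2 x t N)
    (heat_approx_density P phi nu phi_ x t fj).
Proof.
move=> N3 dfj; have N1 : (1 <= N)%N by exact: leq_trans N3.
have dfj' := @is_density_assoc _ _ _ _ _ _ _ _ _ P lebesgue_measure
  (lebesgue_vec R (N - 2)) lebesgue_measure (xi 0%N : T -> mR) (xi_tail xi N)
  (alpha2 : T -> mR) fj dfj.
have := @is_density_affine _ _ _ _ _ P
  (sigma_finite_product (lebesgue_vec R (N - 2)) lebesgue_measure)
  (xi 0%N : T -> mR) (tail_alpha N) (tail_alpha_dom N) (@slope N) (@shift N) _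
  (@measurable_tail_alpha_dom N) (@measurable_slope N) (@measurable_shift N)
  (@slope_neq0 N) (ae_tail_alpha_dom N1) dfj'.
have -> : (fun w => shift (tail_alpha N w) + slope (tail_alpha N w) * xi 0%N w) =
    heat_approx P phi nu phi_ xi alpha2 x t N.
  by apply/funext => w; rewrite heat_approx_affine.
congr is_density; apply/funext => v; rewrite /heat_approx_density.
apply: eq_Rintegral => p; rewrite inE => Dp.
have /= := slope_neq0 Dp; rewrite /slope => s0.
have := s0; rewrite !mulf_eq0 !negb_or => /andP[/andP[_ sq0] h0].
congr (fj (_, _, _) / _).
  (* The factor 2 common to shift and slope is cancelled, which turns v into v / 2. *)
  by rewrite /shift; field; apply/andP.
by rewrite normrM ger0_norm// mulr_ge0// sqrtr_ge0.
Qed.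

(** Independence of xi_1 from the pair (tail, alpha^2) yields the version of the density that can be
    estimated pointwise through [fxi]. *)
Lemma is_density_heat_approx_mix N (fxi : R -> R) : (3 <= N)%N ->
  independent3 P alpha2 (xi 0%N) (xi_tail xi N) ->
  is_density P lebesgue_measure (xi 0%N) fxi ->
  is_density P lebesgue_measure (heat_approx P phi nu phi_ xi alpha2 x t N)
    (mix_density P (xi 0%N) fxi (fun w => slope (tail_alpha N w))
      (heat_approx P phi nu phi_ xi alpha2 x t N)).
Proof.
move=> N3 indep dfxi; have N1 : (1 <= N)%N by exact: leq_trans N3.
pose TA : {mfun T >-> (vec R (N - 2) * mR)%type} :=
  mfun_Sub (mem_set (@measurable_tail_alpha N)).
have ind := @independent3_pair _ _ _ _ T mR mR (vec R (N - 2)) R P alpha2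
  (xi 0%N) (xi_tail xi N) (measurable_funPT alpha2) (measurable_funPT (xi 0%N))
  (@measurable_xi_tail N) indep.
have := @is_density_mix _ _ T _ R P (xi 0%N) TA (tail_alpha_dom N)
  (@slope N) (@shift N) fxi
  (@measurable_tail_alpha_dom N) (@measurable_slope N) (@measurable_shift N)
  (@slope_neq0 N) (ae_tail_alpha_dom N1) ind dfxi.
have -> : (fun w => shift (TA w) + slope (TA w) * xi 0%N w) =
    heat_approx P phi nu phi_ xi alpha2 x t N.
  by apply/funext => w; rewrite heat_approx_affine.
by [].
Qed.

End heat_density.

(** * Uniform convergence of the densities on bounded sets *)

Theorem theorem3p3 (R : realType) (d : measure_display) (T : measurableType d)
    (P : probability T R) (hP : measure_is_complete P)
    (x t : R) (hx : 0 < x < 1) (ht : 0 < t)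
    (alpha2 : {RV P >-> R}) (halpha : {ae P, forall w, 0 < alpha2 w})
    (phi : R -> T -> R) (hphi : L2_process P phi)
    (nu : nat -> R) (phi_ : nat -> R -> R) (xi : nat -> {RV P >-> R})
    (hKL : karhunen_loeve phi nu phi_ xi) (hnu : 0 < nu 0%N)
    (hac : forall N, (3 <= N)%N ->
      [/\ absolutely_continuous P lebesgue_measure alpha2,
          absolutely_continuous P lebesgue_measure (xi 0%N),
          absolutely_continuous P (lebesgue_vec R (N - 2)) (xi_tail xi N) &
          independent3 P alpha2 (xi 0%N) (xi_tail xi N)])
    (fxi : R -> R) (hfxi : is_density P lebesgue_measure (xi 0%N) fxi)
    (hlip : lipschitz fxi)
    (hD : {ae P, forall w, heat_dom_all (phi_ 0%N) x t (alpha2 w)})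
    (hsum : (\sum_(1 <= n <oo)
      'N[P]_2%:E[EFin \o
        (fun w => expR (- (n%:R ^+ 2 * pi ^+ 2 * alpha2 w * t)))%R]
        < +oo)%E)
    (C : R) (hC : 0 < C)
    (hbound : {ae P, forall w, forall N, (1 <= N)%N ->
      C <= `|heat_sum N (phi_ 0%N) x t (alpha2 w)|})
    (fj : forall N,
      (measurableTypeR R * vec R (N - 2) * measurableTypeR R)%type -> R)
    (hfj : forall N, (3 <= N)%N ->
      is_density P (lebesgue_joint R N) (joint_vector xi alpha2 N) (fj N)) :
  (forall N, (3 <= N)%N ->
    is_density P lebesgue_measure (heat_approx P phi nu phi_ xi alpha2 x t N)
      (heat_approx_density P phi nu phi_ x t (fj N))) /\
  exists f : R -> R,
    is_density P lebesgue_measure (heat_solution phi alpha2 x t) f /\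
    forall K : set R, bounded_set K ->
      'N[lebesgue_measure]_+oo [(fun v =>
         (heat_approx_density P phi nu phi_ x t (fj N) v - f v)%:E) \_ K]%E
      @[N --> \oo] --> 0%E.
Proof.
have [L f_lip] := lipschitzP_norm hlip.
have [_ mf f0 _] := hfxi; have fB := lipschitz_density_bounded hfxi f_lip.
split=> [N N3|].
  exact: (is_density_heat_approx_density phi hnu hC halpha hbound N3 (hfj _ N3)).
have sq0 : 0 < Num.sqrt (nu 0%N) by rewrite sqrtr_gt0.
(* The lower bound for the slope, which carries the factor 2 sqrt(nu_1) besides T_N(phi_1). *)
have C0 : 0 < 2 * Num.sqrt (nu 0%N) * C by rewrite !mulr_gt0.
pose X_ n := heat_approx P phi nu phi_ xi alpha2 x t (n + 3).
pose A_ n (w : T) := 2 * Num.sqrt (nu 0%N) * heat_sum (n + 3) (phi_ 0%N) x t (alpha2 w).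
pose A (w : T) := 2 * Num.sqrt (nu 0%N) *
  limn (fun N => heat_sum N (phi_ 0%N) x t (alpha2 w)).
pose X := heat_solution phi alpha2 x t.
have mA_ n : measurable_fun setT (A_ n).
  apply: measurable_funM => //.
  by apply: measurableT_comp => //; exact: measurable_heat_sum.
have A_cvg : {ae P, forall w, A_ n w @[n --> \oo] --> A w}.
  apply: filterS halpha => w aw; apply: cvgM; first exact: cvg_cst.
  rewrite (@cvg_shiftn 3 _ (fun N => heat_sum N (phi_ 0%N) x t (alpha2 w))).
  apply: is_cvg_heat_sum => //; have [e _ _] := kl_basis hKL.
  exact: L2_01_integrable.
have mA : measurable_fun setT A by exact: ae_cvg_measurable A_cvg.
have CA_ n : {ae P, forall w, 2 * Num.sqrt (nu 0%N) * C <= `|A_ n w|}.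
  apply: filterS hbound => w bw.
  rewrite /A_ normrM ger0_norm; last by rewrite mulr_ge0// ltW.
  by rewrite ler_wpM2l ?mulr_ge0 ?(ltW sq0)// bw// addnS.
have mX_ n : measurable_fun setT (X_ n) by exact: measurable_heat_approx.
have mX : measurable_fun setT X.
  exact: (measurable_heat_solution x hphi hP ht halpha).
have X_cvg : cvg0_prob P (fun n w => X_ n w - X w).
  exact: heat_approx_cvg0_prob.
have n3 n : (3 <= n + 3)%N by rewrite leq_addl.
have dX n : is_density P lebesgue_measure (X_ n)
    (mix_density P (xi 0%N) fxi (A_ n) (X_ n)).
  have [_ _ _ indep] := hac _ (n3 n).
  exact: (is_density_heat_approx_mix phi hnu hC halpha hbound (n3 n) indep hfxi).
have mY : measurable_fun setT (xi 0%N) by exact: measurable_funPT.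
exists (mix_density P (xi 0%N) fxi A X); split.
  exact: (is_density_mix_limit mY mf f0 fB f_lip C0 mA_ mX_ mA mX CA_ A_cvg X_cvg dX).
move=> K [M [_ KM]].
rewrite -(cvg_shiftn 3); apply: ge0_cvge0 => [n|e e0]; first exact: Lnorm_ge0.
(* [bounded_set] bounds K by every number beyond M, hence M + 1. The limit density was fixed before
   K. *)
have := mix_density_cvg mY mf f0 fB f_lip C0 mA_ mX_ mA mX CA_ A_cvg X_cvg (M + 1) e0.
apply: filterS => n close; apply: Lnorm_pinfty_le; first exact: ltW.
have dN := is_density_heat_approx_density phi hnu hC halpha hbound (n3 n)
  (hfj _ (n3 n)).
(* Outside a null set of v, the stated density is replaced by the mixed one, for which the bound
   holds at every point of K. *)
apply: filterS (is_density_ae_eq dN (dX n)) => v fvE.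
rewrite patchE; case: ifPn => vK; last by rewrite abse0 lee_fin ltW.
rewrite fvE lee_fin; apply: close; apply: (KM (M + 1)).
  by rewrite ltrDl.
by rewrite inE in vK.
Qed.
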